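(* Let $\{a_n\}_{n=1}^\infty$ be a sequence of real numbers such that $a_n=O(n^\alpha)$ for some real number $\alpha$. Assume that, for some real number $r\ge 0$, the Dirichlet series $\sum_{n=1}^\infty \frac{a_n}{n^s}$ can be analytically continued to $\operatorname{Re}(s)>r$ and has polynomial growth in $\operatorname{Im}(s)$ in this region. Furthermore, assume that the Dirichlet series $\sum_{n=1}^\infty\frac{a_n^2}{n^s}$ has a singularity at $s=k$ for some real number $k>0$ such that $\alpha+r<k$. Then the sequence $\{a_n\}_{n=1}^\infty$ changes signs infinitely often.
   Context: A sequence of real numbers changes signs infinitely often if it has infinitely many strictly positive terms and infinitely many strictly negative terms. Since $a_n=O(n^\alpha)$, both Dirichlet series converge absolutely in some right half-plane and define holomorphic functions there. Standard conventions: ''analytically continued to $\operatorname{Re}(s)>r$'' means that there is a holomorphic function $M$ on $\{\operatorname{Re}(s)>r\}$ agreeing with the series for $\operatorname{Re}(s)$ sufficiently large; ''polynomial growth in $\operatorname{Im}(s)$'' means that for all real $r<\sigma_1\le\sigma_2$ there are constants $C,A>0$ with $|M(s)|\le C(1+|\operatorname{Im}(s)|)^A$ whenever $\sigma_1\le\operatorname{Re}(s)\le\sigma_2$; ''$\sum a_n^2n^{-s}$ has a singularity at $s=k$'' means that the holomorphic function it defines for $\operatorname{Re}(s)$ large cannot be continued to a function holomorphic at the point $s=k$ (that is, there is no holomorphic continuation to a connected open set containing a right half-plane and the real ray $[k,\infty)$). *)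

(* Defs.v *)
From Stdlib Require Import Reals.
From Coquelicot Require Import Coquelicot.

Open Scope R_scope.

(** Sequences [a : nat -> R] stand for [(a_n)] with [n >= 1]; the value [a 0]
    is never used. *)

Definition changes_signs_infinitely_often (a : nat -> R) : Prop :=
  (forall N : nat, exists n : nat, (N < n)%nat /\ 0 < a n) /\
  (forall N : nat, exists n : nat, (N < n)%nat /\ a n < 0).

Definition is_O_power (a : nat -> R) (alpha : R) : Prop :=
  exists K : R, eventually (fun n => Rabs (a n) <= K * Rpower (INR n) alpha).

Definition Cexp (z : C) : C :=
  (exp (Re z) * cos (Im z), exp (Re z) * sin (Im z)).

(** [n ^ s] for an integer [n >= 1], with the real logarithm of [n]. *)
Definition nat_Cpow (n : nat) (s : C) : C :=
  Cexp (Cmult s (RtoC (ln (INR n)))).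

(** [is_series] sums from index 0, hence the shift. *)
Definition is_dirichlet_series (a : nat -> R) (s l : C) : Prop :=
  @is_series C_AbsRing C_NormedModule
    (fun n => Cdiv (RtoC (a (S n))) (nat_Cpow (S n) s)) l.

Definition right_half_plane (r : R) (s : C) : Prop := r < Re s.

(** Used for open [U] only. *)
Definition holomorphic_on (U : C -> Prop) (f : C -> C) : Prop :=
  forall z : C, U z -> @ex_derive C_AbsRing C_NormedModule f z.

Definition extends_dirichlet_series (a : nat -> R) (M : C -> C) : Prop :=
  exists sigma0 : R,
    forall s : C, right_half_plane sigma0 s -> is_dirichlet_series a s (M s).

Definition polynomial_growth (r : R) (M : C -> C) : Prop :=
  forall sigma1 sigma2 : R, r < sigma1 -> sigma1 <= sigma2 ->
    exists K A : R, 0 < K /\ 0 < A /\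
      forall s : C, sigma1 <= Re s <= sigma2 ->
        Cmod (M s) <= K * Rpower (1 + Rabs (Im s)) A.

Definition connected_set (U : C -> Prop) : Prop :=
  forall A B : C -> Prop,
    open A -> open B ->
    (forall z, U z -> A z \/ B z) ->
    (exists z, U z /\ A z) -> (exists z, U z /\ B z) ->
    exists z, U z /\ A z /\ B z.

Definition dirichlet_series_singular_at (a : nat -> R) (k : R) : Prop :=
  ~ exists (U : C -> Prop) (f : C -> C),
      open U /\ connected_set U /\
      (exists sigma0 : R, forall s : C, right_half_plane sigma0 s -> U s) /\
      (forall t : R, k <= t -> U (RtoC t)) /\
      holomorphic_on U f /\ extends_dirichlet_series a f.

(* Main.v *)
Require Import Defs.
From Stdlib Require Import Reals.
From Coquelicot Require Import Coquelicot.
From Stdlib Require Import Lra Lia Factorial Classical IndefiniteDescription.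
Open Scope R_scope.

(** Suppose that the terms [a n] are eventually of one sign; replacing [a] by
    [- a], let them be eventually nonnegative. Landau's theorem then says that
    a Dirichlet series converges as far to the left as the function it defines
    continues, here absolutely for [Re s > r] ([landau_absolute_convergence]).
    Since [a n ^ 2 <= K * n ^ alpha * |a n|], the series of squares converges
    absolutely for [Re s > alpha + r] ([squares_converge_absolutely]), so its
    sum is holomorphic on a half-plane that contains [k]
    ([dirichlet_sum_holomorphic]): there is no singularity at [k].

    Landau's theorem is a statement about Taylor coefficients. Around a real
    point [c] far to the right, the [m]-th coefficient of the sum is
    [(-1)^m] times the sum of [a_n n^(-c) (ln n)^m / m!], while Cauchy's
    estimate bounds it by a constant times [rho^(-m)] for every [rho < c - r].
    Multiplying by [(c - sigma)^m] with [r < sigma] and [c - sigma < rho], then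
    adding over [m], turns the powers of [ln n] into the exponential
    [n^(c - sigma)]. As almost all terms are nonnegative, this bounds the
    partial sums of [a_n n^(-sigma)].

    Cauchy's estimate is obtained in logarithmic polar coordinates. The function
    [M(c + e^z) e^(-m z)] is holomorphic and [2 pi i]-periodic where
    [e^(Re z) < c - r], so the Goursat theorem on rectangles of height [2 pi]
    says that its mean over vertical segments of that height does not depend on
    [Re z] ([circle_mean_invariant]). At [Re z = 0], the circle of radius 1, the
    mean is computed from the Dirichlet series ([circle_mean_dirichlet]); at
    [Re z = ln rho] it is at most a constant times [rho^(-m)]
    ([circle_mean_bound]). As the derivative of [M] is not known to be
    continuous, Goursat's bisection argument is needed; it is carried out for
    real one-forms [p dx + q dy] that are differentiable and closed at each
    point ([circulation_closed_form]). *)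

(** * Goursat theorem on rectangles *)

Lemma nested_halving_point (x : nat -> R) (w : R) :
  (forall n, x n <= x (S n) /\ x (S n) + w / 2 ^ S n <= x n + w / 2 ^ n) ->
  0 <= w ->
  exists X, forall n, x n <= X <= x n + w / 2 ^ n.
Proof.
  intros Hx Hw.
  assert (Hpos : forall n, 0 <= w / 2 ^ n).
  { intros n. apply Rdiv_le_0_compat; [exact Hw | apply pow_lt; lra]. }
  assert (Hmono : forall n m, x n <= x (n + m)%nat).
  { intros n m; induction m as [|m IH]; [rewrite Nat.add_0_r; lra|].
    rewrite Nat.add_succ_r. destruct (Hx (n + m)%nat). lra. }
  assert (Hanti : forall n m, x (n + m)%nat + w / 2 ^ (n + m) <= x n + w / 2 ^ n).
  { intros n m; induction m as [|m IH]; [rewrite Nat.add_0_r; lra|].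
    rewrite Nat.add_succ_r. destruct (Hx (n + m)%nat). lra. }
  assert (Hle : forall n m, x m <= x n + w / 2 ^ n).
  { intros n m. generalize (Hanti n m) (Hmono m n) (Hpos (n + m)%nat).
    rewrite (Nat.add_comm m n). lra. }
  destruct (completeness (fun t => exists n, t = x n)) as [X [Hub Hlub]].
  - exists (x O + w / 2 ^ 0). intros t [n ->]. apply Hle.
  - exists (x O), O. reflexivity.
  - exists X. intros n. split.
    + apply Hub. exists n. reflexivity.
    + apply Hlub. intros t [m ->]. apply Hle.
Qed.

(** The bisection principle behind Goursat's proof: [P n x y] is to be read as
    a property of the rectangle with lower left corner [(x, y)] and sides
    [w / 2 ^ n], [h / 2 ^ n], inherited by one of its four quarters. The chosen
    rectangles shrink to the point [(X, Y)]. *)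
Lemma quartering_point (P : nat -> R -> R -> Prop) (x0 y0 w h : R) :
  0 <= w -> 0 <= h -> P O x0 y0 ->
  (forall n x y, P n x y ->
     exists x' y', P (S n) x' y' /\
       (x' = x \/ x' = x + w / 2 ^ S n) /\ (y' = y \/ y' = y + h / 2 ^ S n)) ->
  exists X Y, x0 <= X <= x0 + w /\ y0 <= Y <= y0 + h /\
    forall n, exists x y, P n x y /\
      x <= X <= x + w / 2 ^ n /\ y <= Y <= y + h / 2 ^ n.
Proof.
  intros Hw Hh P0 Hstep.
  assert (next : forall n (s : {s : R * R | P n (fst s) (snd s)}),
    {s' : {s' : R * R | P (S n) (fst s') (snd s')} |
       (fst (proj1_sig s') = fst (proj1_sig s) \/
        fst (proj1_sig s') = fst (proj1_sig s) + w / 2 ^ S n) /\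
       (snd (proj1_sig s') = snd (proj1_sig s) \/
        snd (proj1_sig s') = snd (proj1_sig s) + h / 2 ^ S n)}).
  { intros n [[x y] Hs]. apply constructive_indefinite_description.
    destruct (Hstep n x y Hs) as (x' & y' & HP & Hx & Hy).
    exists (exist (fun s' : R * R => P (S n) (fst s') (snd s')) (x', y') HP).
    simpl. split; assumption. }
  set (s := nat_rect (fun n => {s : R * R | P n (fst s) (snd s)})
              (exist (fun s : R * R => P O (fst s) (snd s)) (x0, y0) P0)
              (fun n s => proj1_sig (next n s))).
  assert (Hhalf : forall v n, v / 2 ^ n = v / 2 ^ S n + v / 2 ^ S n).
  { intros v n. simpl. field. apply pow_nonzero. lra. }
  assert (Hpos : forall v n, 0 <= v -> 0 <= v / 2 ^ n).
  { intros v n Hv. apply Rdiv_le_0_compat; [exact Hv | apply pow_lt; lra]. }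
  destruct (nested_halving_point (fun n => fst (proj1_sig (s n))) w) as [X HX]; [|exact Hw|].
  { intros n. destruct (proj2_sig (next n (s n))) as [H _].
    change (s (S n)) with (proj1_sig (next n (s n))).
    generalize (Hhalf w n) (Hpos w (S n) Hw). lra. }
  destruct (nested_halving_point (fun n => snd (proj1_sig (s n))) h) as [Y HY]; [|exact Hh|].
  { intros n. destruct (proj2_sig (next n (s n))) as [_ H].
    change (s (S n)) with (proj1_sig (next n (s n))).
    generalize (Hhalf h n) (Hpos h (S n) Hh). lra. }
  exists X, Y. split; [|split].
  - generalize (HX O). simpl. lra.
  - generalize (HY O). simpl. lra.
  - intros n. exists (fst (proj1_sig (s n))), (snd (proj1_sig (s n))).
    split; [exact (proj2_sig (s n))|]. split; [apply HX | apply HY].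
Qed.

(** The one-form [p dx + q dy] is Frechet differentiable at [(x, y)] and its
    exterior derivative vanishes there: the cross partial derivatives are the
    same number [b]. *)
Definition closed_form_at (p q : R -> R -> R) (x y : R) : Prop :=
  exists a b d, differentiable_pt_lim p x y a b /\ differentiable_pt_lim q x y b d.

(** Counterclockwise integral of [p dx + q dy] along the boundary of the
    rectangle with corner [(x, y)] and sides [w], [h]; opposite edges are paired
    so that affine forms can be estimated under a single integral. *)
Definition circulation (p q : R -> R -> R) (x w y h : R) : R :=
  RInt (fun t => p t y - p t (y + h)) x (x + w) +
  RInt (fun t => q (x + w) t - q x t) y (y + h).

Definition closed_on_rectangle (p q : R -> R -> R) (x w y h : R) : Prop :=
  forall s t, x <= s <= x + w -> y <= t <= y + h -> closed_form_at p q s t.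

Lemma closed_on_subrectangle p q x w y h x' w' y' h' :
  x <= x' -> x' + w' <= x + w -> y <= y' -> y' + h' <= y + h ->
  closed_on_rectangle p q x w y h -> closed_on_rectangle p q x' w' y' h'.
Proof. intros H1 H2 H3 H4 H s t Hs Ht. apply H; lra. Qed.

Lemma differentiable_pt_lim_continuous (f : R -> R -> R) x y a b :
  differentiable_pt_lim f x y a b ->
  continuous (fun t => f t y) x /\ continuous (fun t => f x t) y.
Proof.
  intros H.
  assert (Hc : continuity_2d_pt f x y).
  { apply differentiable_continuity_pt. exists a, b. exact H. }
  split; apply filterlim_locally; intros eps; destruct (Hc eps) as [d Hd];
  exists d; intros t Ht; apply Hd; try exact Ht;
  rewrite Rminus_diag, Rabs_R0; apply d.
Qed.

Lemma ex_RInt_horizontal p q x w y h s s' t :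
  closed_on_rectangle p q x w y h ->
  x <= s -> s <= s' -> s' <= x + w -> y <= t <= y + h ->
  ex_RInt (fun u => p u t) s s'.
Proof.
  intros Hc H1 H2 H3 Ht. apply (ex_RInt_continuous (V := R_CompleteNormedModule)).
  rewrite Rmin_left, Rmax_right by exact H2. intros u Hu.
  destruct (Hc u t) as (a & b & d & Hp & _); [lra | exact Ht |].
  exact (proj1 (differentiable_pt_lim_continuous p u t a b Hp)).
Qed.

Lemma ex_RInt_vertical p q x w y h s t t' :
  closed_on_rectangle p q x w y h ->
  y <= t -> t <= t' -> t' <= y + h -> x <= s <= x + w ->
  ex_RInt (fun u => q s u) t t'.
Proof.
  intros Hc H1 H2 H3 Hs. apply (ex_RInt_continuous (V := R_CompleteNormedModule)).
  rewrite Rmin_left, Rmax_right by exact H2. intros u Hu.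
  destruct (Hc s u) as (a & b & d & _ & Hq); [exact Hs | lra |].
  exact (proj2 (differentiable_pt_lim_continuous q s u b d Hq)).
Qed.

Lemma circulation_edges p q x w y h :
  closed_on_rectangle p q x w y h -> 0 <= w -> 0 <= h ->
  circulation p q x w y h =
  RInt (fun t => p t y) x (x + w) - RInt (fun t => p t (y + h)) x (x + w) +
  (RInt (fun t => q (x + w) t) y (y + h) - RInt (fun t => q x t) y (y + h)).
Proof.
  intros Hc Hw Hh. unfold circulation. f_equal.
  - apply (RInt_minus (V := R_CompleteNormedModule) (fun t => p t y) (fun t => p t (y + h)));
    apply (ex_RInt_horizontal p q _ _ _ _ _ _ _ Hc); lra.
  - apply (RInt_minus (V := R_CompleteNormedModule) (fun t => q (x + w) t) (fun t => q x t));
    apply (ex_RInt_vertical p q _ _ _ _ _ _ _ Hc); lra.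
Qed.

Lemma circulation_quarters p q x w y h :
  closed_on_rectangle p q x (w + w) y (h + h) -> 0 <= w -> 0 <= h ->
  circulation p q x (w + w) y (h + h) =
  circulation p q x w y h + circulation p q (x + w) w y h +
  (circulation p q x w (y + h) h + circulation p q (x + w) w (y + h) h).
Proof.
  intros Hc Hw Hh.
  rewrite !circulation_edges
    by (try lra; apply (closed_on_subrectangle p q x (w + w) y (h + h)); lra || exact Hc).
  replace (x + (w + w)) with (x + w + w) by ring.
  replace (y + (h + h)) with (y + h + h) by ring.
  assert (Hp : forall z, y <= z <= y + (h + h) ->
    RInt (fun t => p t z) x (x + w + w) =
    RInt (fun t => p t z) x (x + w) + RInt (fun t => p t z) (x + w) (x + w + w)).
  { intros z Hz. symmetry. apply (RInt_Chasles (V := R_CompleteNormedModule));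
    apply (ex_RInt_horizontal p q _ _ _ _ _ _ _ Hc); lra. }
  assert (Hq : forall z, x <= z <= x + (w + w) ->
    RInt (fun t => q z t) y (y + h + h) =
    RInt (fun t => q z t) y (y + h) + RInt (fun t => q z t) (y + h) (y + h + h)).
  { intros z Hz. symmetry. apply (RInt_Chasles (V := R_CompleteNormedModule));
    apply (ex_RInt_vertical p q _ _ _ _ _ _ _ Hc); lra. }
  rewrite !Hp, !Hq by lra. ring.
Qed.

(** The constant and diagonal terms of the first-order expansions of [p] and
    [q] at [(X, Y)] cancel between opposite edges; the cross terms contribute
    [- b * h * w] and [b * w * h] and cancel each other. Only the remainders are
    left: each edge integral is at most a small multiple of [w + h] times the
    length of the edge. *)
Lemma circulation_small p q X Y (eps : R) :
  closed_form_at p q X Y -> 0 < eps ->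
  exists delta, 0 < delta /\ forall x w y h,
    closed_on_rectangle p q x w y h -> 0 <= w -> 0 <= h ->
    w < delta -> h < delta -> x <= X <= x + w -> y <= Y <= y + h ->
    Rabs (circulation p q x w y h) <= eps * (w + h) ^ 2.
Proof.
  intros (a & b & d & Hp & Hq) Heps.
  assert (Heps2 : 0 < eps / 2) by lra.
  destruct (Hp (mkposreal _ Heps2)) as [d1 H1].
  destruct (Hq (mkposreal _ Heps2)) as [d2 H2]. simpl in H1, H2.
  exists (Rmin d1 d2). split; [apply Rmin_glb_lt; [apply d1 | apply d2]|].
  intros x w y h Hc Hw Hh Hwd Hhd HX HY.
  generalize (Rmin_l d1 d2) (Rmin_r d1 d2); intros Hd1 Hd2.
  assert (Hnear : forall s t, x <= s <= x + w -> y <= t <= y + h ->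
    Rabs (s - X) <= w /\ Rabs (t - Y) <= h).
  { intros s t Hs Ht. split; apply Rabs_le; lra. }
  assert (Bp : forall s t, x <= s <= x + w -> y <= t <= y + h ->
    Rabs (p s t - p X Y - (a * (s - X) + b * (t - Y))) <= eps / 2 * (w + h)).
  { intros s t Hs Ht. destruct (Hnear s t Hs Ht) as [N1 N2].
    apply Rle_trans with (1 := H1 s t ltac:(lra) ltac:(lra)).
    apply Rmult_le_compat_l; [lra|]. apply Rmax_lub; lra. }
  assert (Bq : forall s t, x <= s <= x + w -> y <= t <= y + h ->
    Rabs (q s t - q X Y - (b * (s - X) + d * (t - Y))) <= eps / 2 * (w + h)).
  { intros s t Hs Ht. destruct (Hnear s t Hs Ht) as [N1 N2].
    apply Rle_trans with (1 := H2 s t ltac:(lra) ltac:(lra)).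
    apply Rmult_le_compat_l; [lra|]. apply Rmax_lub; lra. }
  assert (I1 : Rabs (RInt (fun t => p t y - p t (y + h)) x (x + w) + b * h * w)
               <= w * (eps * (w + h))).
  { assert (E : ex_RInt (fun t => p t y - p t (y + h)) x (x + w)).
    { apply (ex_RInt_minus (V := R_NormedModule)); apply (ex_RInt_horizontal p q _ _ _ _ _ _ _ Hc); lra. }
    replace (RInt (fun t => p t y - p t (y + h)) x (x + w) + b * h * w) with
      (RInt (fun t => (p t y - p t (y + h)) + b * h) x (x + w)).
    - replace (w * (eps * (w + h))) with ((x + w - x) * (eps * (w + h))) by ring.
      apply abs_RInt_le_const; [lra | |].
      + apply (ex_RInt_plus (V := R_NormedModule)); [exact E | apply ex_RInt_const].
      + intros t Ht. generalize (Bp t y Ht ltac:(lra)) (Bp t (y + h) Ht ltac:(lra)).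
        intros K1 K2. apply Rabs_le_between in K1. apply Rabs_le_between in K2.
        apply Rabs_le. lra.
    - rewrite (RInt_plus (V := R_CompleteNormedModule)
        (fun t => p t y - p t (y + h)) (fun _ => b * h));
      [|exact E | apply ex_RInt_const].
      rewrite RInt_const. unfold plus, scal; simpl; unfold mult; simpl. ring. }
  assert (I2 : Rabs (RInt (fun t => q (x + w) t - q x t) y (y + h) - b * w * h)
               <= h * (eps * (w + h))).
  { assert (E : ex_RInt (fun t => q (x + w) t - q x t) y (y + h)).
    { apply (ex_RInt_minus (V := R_NormedModule) (fun t => q (x + w) t) (fun t => q x t));
      apply (ex_RInt_vertical p q _ _ _ _ _ _ _ Hc); lra. }
    replace (RInt (fun t => q (x + w) t - q x t) y (y + h) - b * w * h) with
      (RInt (fun t => (q (x + w) t - q x t) - b * w) y (y + h)).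
    - replace (h * (eps * (w + h))) with ((y + h - y) * (eps * (w + h))) by ring.
      apply abs_RInt_le_const; [lra | |].
      + apply (ex_RInt_minus (V := R_NormedModule)); [exact E | apply ex_RInt_const].
      + intros t Ht. generalize (Bq x t ltac:(lra) Ht) (Bq (x + w) t ltac:(lra) Ht).
        intros K1 K2. apply Rabs_le_between in K1. apply Rabs_le_between in K2.
        apply Rabs_le. lra.
    - rewrite (RInt_minus (V := R_CompleteNormedModule)
        (fun t => q (x + w) t - q x t) (fun _ => b * w));
      [|exact E | apply ex_RInt_const].
      rewrite RInt_const. unfold minus, plus, opp, scal; simpl; unfold mult; simpl. ring. }
  unfold circulation.
  apply Rabs_le_between in I1. apply Rabs_le_between in I2.
  apply Rabs_le. simpl. lra.
Qed.

(** If the circulation were not zero, one quarter of the rectangle would carry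
    at least a quarter of it, and so on; around the limit point this contradicts
    [circulation_small], as [(w + h) ^ 2] is also divided by 4 at each step. *)
Lemma circulation_closed_form p q x0 w0 y0 h0 :
  closed_on_rectangle p q x0 w0 y0 h0 -> 0 <= w0 -> 0 <= h0 ->
  circulation p q x0 w0 y0 h0 = 0.
Proof.
  intros Hclosed Hw Hh.
  destruct (Req_dec (circulation p q x0 w0 y0 h0) 0) as [|Hne]; [assumption | exfalso].
  set (k := Rabs (circulation p q x0 w0 y0 h0)).
  assert (Hk : 0 < k) by (apply Rabs_pos_lt; exact Hne).
  set (P := fun n x y => closed_on_rectangle p q x (w0 / 2 ^ n) y (h0 / 2 ^ n) /\
              k / 4 ^ n <= Rabs (circulation p q x (w0 / 2 ^ n) y (h0 / 2 ^ n))).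
  assert (Hpos : forall v n, 0 <= v -> 0 <= v / 2 ^ n).
  { intros v n Hv. apply Rdiv_le_0_compat; [exact Hv | apply pow_lt; lra]. }
  destruct (quartering_point P x0 y0 w0 h0 Hw Hh) as (X & Y & HX & HY & Hn).
  - split; simpl; unfold Rdiv; rewrite ?Rinv_1, ?Rmult_1_r; [exact Hclosed | unfold k; lra].
  - intros n x y [Hin Hbad].
    assert (Hhalf : forall v, v / 2 ^ n = v / 2 ^ S n + v / 2 ^ S n).
    { intros v. simpl. field. apply pow_nonzero. lra. }
    assert (H4 : k / 4 ^ n = 4 * (k / 4 ^ S n)).
    { simpl. field. apply pow_nonzero. lra. }
    rewrite (Hhalf w0), (Hhalf h0) in Hin, Hbad. rewrite H4 in Hbad.
    unfold P.
    generalize (Hpos w0 (S n) Hw) (Hpos h0 (S n) Hh).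
    set (W := w0 / 2 ^ S n) in *. set (H := h0 / 2 ^ S n) in *.
    set (e := k / 4 ^ S n) in *. intros HW HH.
    rewrite (circulation_quarters p q x W y H Hin HW HH) in Hbad.
    destruct (Rle_lt_dec e (Rabs (circulation p q x W y H))) as [|B1].
    { exists x, y. repeat split; auto.
      apply (closed_on_subrectangle p q x (W + W) y (H + H)); lra || exact Hin. }
    destruct (Rle_lt_dec e (Rabs (circulation p q (x + W) W y H))) as [|B2].
    { exists (x + W), y. repeat split; auto.
      apply (closed_on_subrectangle p q x (W + W) y (H + H)); lra || exact Hin. }
    destruct (Rle_lt_dec e (Rabs (circulation p q x W (y + H) H))) as [|B3].
    { exists x, (y + H). repeat split; auto.
      apply (closed_on_subrectangle p q x (W + W) y (H + H)); lra || exact Hin. }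
    destruct (Rle_lt_dec e (Rabs (circulation p q (x + W) W (y + H) H))) as [|B4].
    { exists (x + W), (y + H). repeat split; auto.
      apply (closed_on_subrectangle p q x (W + W) y (H + H)); lra || exact Hin. }
    exfalso.
    apply Rabs_lt_between in B1. apply Rabs_lt_between in B2.
    apply Rabs_lt_between in B3. apply Rabs_lt_between in B4.
    apply Rle_not_lt in Hbad. apply Hbad. apply Rabs_lt_between. lra.
  (* This eps makes the bound of circulation_small less than k / 4 ^ n. *)
  - set (eps := k / (2 * (1 + (w0 + h0) ^ 2))).
    assert (Hs : 0 <= (w0 + h0) ^ 2) by (apply pow2_ge_0).
    assert (Heps : 0 < eps) by (apply Rdiv_lt_0_compat; lra).
    destruct (circulation_small p q X Y eps (Hclosed X Y HX HY) Heps) as (delta & Hdelta & Hsmall).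
    assert (Hlim : exists n, (w0 + h0) / 2 ^ n < delta).
    { destruct (pow_lt_1_zero (/ 2) ltac:(rewrite Rabs_pos_eq; lra)
         (delta / (1 + (w0 + h0))) ltac:(apply Rdiv_lt_0_compat; lra)) as [n Hn'].
      exists n. specialize (Hn' n (le_n n)).
      rewrite pow_inv, Rabs_pos_eq in Hn'
        by (left; apply Rinv_0_lt_compat, pow_lt; lra).
      apply Rle_lt_trans with ((1 + (w0 + h0)) * / 2 ^ n).
      - apply Rmult_le_compat_r; [left; apply Rinv_0_lt_compat, pow_lt; lra | lra].
      - apply Rlt_le_trans with ((1 + (w0 + h0)) * (delta / (1 + (w0 + h0)))).
        + apply Rmult_lt_compat_l; lra.
        + right. field. lra. }
    destruct Hlim as [n Hlt].
    destruct (Hn n) as (x & y & [Hin Hbad] & HXn & HYn).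
    assert (Hsplit : (w0 + h0) / 2 ^ n = w0 / 2 ^ n + h0 / 2 ^ n) by (unfold Rdiv; ring).
    generalize (Hpos w0 n Hw) (Hpos h0 n Hh). intros P1 P2.
    assert (Hle := Hsmall x _ y _ Hin P1 P2 ltac:(lra) ltac:(lra) HXn HYn).
    rewrite <- Hsplit in Hle.
    replace (((w0 + h0) / 2 ^ n) ^ 2) with ((w0 + h0) ^ 2 / 4 ^ n) in Hle.
    + assert (H4 : 0 < / 4 ^ n) by (apply Rinv_0_lt_compat, pow_lt; lra).
      assert (Hfin : k * / 4 ^ n <= (eps * (w0 + h0) ^ 2) * / 4 ^ n).
      { unfold Rdiv in Hbad, Hle. rewrite <- Rmult_assoc in Hle. lra. }
      apply Rmult_le_reg_r in Hfin; [|exact H4].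
      assert (Heq : eps * (1 + (w0 + h0) ^ 2) = k / 2) by (unfold eps; field; lra).
      rewrite Rmult_plus_distr_l in Heq. lra.
    + replace 4 with (2 * 2) by ring. rewrite Rpow_mult_distr. field.
      apply pow_nonzero. lra.
Qed.

(** * Complex derivatives and the exponential *)

Lemma Cmod_le_Re_Im (z : C) : Cmod z <= Rabs (Re z) + Rabs (Im z).
Proof.
  destruct z as [x y].
  replace (x, y) with (RtoC x + Ci * RtoC y)%C at 1
    by (apply injective_projections; simpl; ring).
  apply Rle_trans with (1 := Cmod_triangle _ _).
  rewrite Cmod_mult, !Cmod_R, Cmod_Ci, Rmult_1_l. apply Rle_refl.
Qed.

(** The uniform structure of [C_NormedModule] is that of a product, whereas
    [is_derive] takes its neighbourhoods from the modulus on [C_AbsRing]; this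
    form speaks of the modulus only. *)
Lemma is_derive_C_epsilon (f : C -> C) (z l : C) :
  @is_derive C_AbsRing C_NormedModule f z l <->
  forall eps : posreal, exists delta : posreal, forall w : C,
    Cmod (w - z) < delta -> Cmod (f w - f z - (w - z) * l) <= eps * Cmod (w - z).
Proof.
  split.
  - intros [_ H] eps.
    destruct (H z (fun P HP => HP) eps) as [delta Hd].
    exists delta. intros w Hw. exact (Hd w Hw).
  - intros H. split.
    + apply is_linear_scal_l.
    + intros x Hx eps.
      assert (E : z = x).
      { apply (is_filter_lim_locally_unique (K := C_AbsRing)
          (V := AbsRing_NormedModule C_AbsRing)). exact Hx. }
      rewrite <- E.
      destruct (H eps) as [delta Hd]. exists delta. intros w Hw. exact (Hd w Hw).
Qed.

(** Gives access to the product and chain rules, which are stated for functions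
    from an absolute-value ring to itself. *)
Lemma is_derive_C_AbsRing (f : C -> C) (z l : C) :
  @is_derive C_AbsRing C_NormedModule f z l <->
  @is_derive C_AbsRing (AbsRing_NormedModule C_AbsRing) f z l.
Proof.
  rewrite is_derive_C_epsilon. split.
  - intros H. split.
    + apply is_linear_scal_l.
    + intros x Hx eps.
      assert (E : z = x).
      { apply (is_filter_lim_locally_unique (K := C_AbsRing)
          (V := AbsRing_NormedModule C_AbsRing)). exact Hx. }
      rewrite <- E.
      destruct (H eps) as [delta Hd]. exists delta. intros w Hw. exact (Hd w Hw).
  - intros [_ H] eps.
    destruct (H z (fun P HP => HP) eps) as [delta Hd].
    exists delta. intros w Hw. exact (Hd w Hw).
Qed.

Lemma is_derive_mult_C (f g : C -> C) (z df dg : C) :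
  @is_derive C_AbsRing C_NormedModule f z df ->
  @is_derive C_AbsRing C_NormedModule g z dg ->
  @is_derive C_AbsRing C_NormedModule (fun w => f w * g w)%C z (df * g z + f z * dg)%C.
Proof.
  intros Hf Hg. apply is_derive_C_AbsRing in Hf. apply is_derive_C_AbsRing in Hg.
  apply is_derive_C_AbsRing. apply (is_derive_mult (K := C_AbsRing)); auto.
  intros; apply Cmult_comm.
Qed.

Lemma is_derive_comp_C (f g : C -> C) (z df dg : C) :
  @is_derive C_AbsRing C_NormedModule f (g z) df ->
  @is_derive C_AbsRing C_NormedModule g z dg ->
  @is_derive C_AbsRing C_NormedModule (fun w => f (g w)) z (dg * df)%C.
Proof.
  intros Hf Hg. apply is_derive_C_AbsRing in Hg.
  exact (is_derive_comp (K := C_AbsRing) (V := C_NormedModule) f g z df dg Hf Hg).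
Qed.

Lemma is_derive_affine_C (a b z : C) :
  @is_derive C_AbsRing C_NormedModule (fun w => a + b * w)%C z b.
Proof.
  apply is_derive_C_epsilon. intros eps. exists (mkposreal _ Rlt_0_1). intros w _.
  replace (a + b * w - (a + b * z) - (w - z) * b)%C with (RtoC 0) by ring.
  rewrite Cmod_0. apply Rmult_le_pos; [left; apply eps | apply Cmod_ge_0].
Qed.

(** The form [Im g dx + Re g dy] is the imaginary part of [g dz], closed by the
    Cauchy-Riemann equations. This part is the one of interest: on vertical
    edges it integrates [Re g]. *)
Lemma cauchy_riemann_closed_form (g : C -> C) (x y : R) :
  @ex_derive C_AbsRing C_NormedModule g (x, y) ->
  closed_form_at (fun s t => Im (g (s, t))) (fun s t => Re (g (s, t))) x y.
Proof.
  intros [[l1 l2] H]. exists l2, l1, (- l2).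
  rewrite is_derive_C_epsilon in H.
  assert (K : forall eps : posreal, locally_2d (fun s t =>
    Cmod (g (s, t) - g (x, y) - (s - x, t - y) * (l1, l2)) <=
      eps * Rmax (Rabs (s - x)) (Rabs (t - y))) x y).
  { intros eps. assert (He : 0 < eps / 2) by (generalize (cond_pos eps); lra).
    destruct (H (mkposreal _ He)) as [d Hd].
    assert (Hd2 : 0 < d / 2) by (generalize (cond_pos d); lra).
    assert (Hs2 : sqrt 2 <= 2).
    { rewrite <- (sqrt_Rsqr 2) at 2 by lra. apply sqrt_le_1_alt. unfold Rsqr; lra. }
    exists (mkposreal _ Hd2). simpl. intros s t Hs Ht.
    assert (Hm : Cmod ((s, t) - (x, y)) <= 2 * Rmax (Rabs (s - x)) (Rabs (t - y))).
    { apply Rle_trans with (1 := Cmod_2Rmax ((s, t) - (x, y))). simpl.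
      apply Rmult_le_compat_r; [|exact Hs2].
      apply Rle_trans with (1 := Rabs_pos (s - x)). apply Rmax_l. }
    assert (Hlt : Rmax (Rabs (s - x)) (Rabs (t - y)) < d / 2)
      by (apply Rmax_lub_lt; assumption).
    apply Rle_trans with (1 := Hd (s, t) ltac:(lra)). simpl.
    apply Rle_trans with (eps / 2 * (2 * Rmax (Rabs (s - x)) (Rabs (t - y)))).
    - apply Rmult_le_compat_l; [lra | exact Hm].
    - right; field. }
  split; intros eps; destruct (K eps) as [d Hd]; exists d; intros s t Hs Ht;
  apply Rle_trans with (2 := Hd s t Hs Ht);
  apply Rle_trans with (2 := Rmax_Cmod _).
  - apply Rle_trans with (2 := Rmax_r _ _). right. f_equal. simpl. unfold Im. ring.
  - apply Rle_trans with (2 := Rmax_l _ _). right. f_equal. simpl. unfold Re. ring.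
Qed.

Lemma Cexp_plus z w : Cexp (z + w) = (Cexp z * Cexp w)%C.
Proof.
  destruct z as [a b], w as [c d]. unfold Cexp, Cmult, Cplus; simpl.
  rewrite exp_plus, cos_plus, sin_plus. f_equal; ring.
Qed.

Lemma Cmod_Cexp z : Cmod (Cexp z) = exp (Re z).
Proof.
  unfold Cmod, Cexp; simpl.
  replace (_ + _) with ((exp (Re z)) ^ 2 * ((sin (Im z))² + (cos (Im z))²))
    by (unfold Rsqr; ring).
  rewrite sin2_cos2, Rmult_1_r. apply sqrt_pow2. left; apply exp_pos.
Qed.

Lemma Cexp_0 : Cexp 0 = 1.
Proof. unfold Cexp, RtoC; simpl. rewrite exp_0, cos_0, sin_0. f_equal; ring. Qed.

(** The mean value theorem, applied twice. *)
Lemma second_order_remainder (f f1 f2 : R -> R) (B : R) :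
  (forall t, is_derive f t (f1 t)) -> (forall t, is_derive f1 t (f2 t)) ->
  f 0 = 0 -> f1 0 = 0 ->
  (forall t, 0 <= t <= 1 -> Rabs (f2 t) <= B) -> Rabs (f 1) <= B.
Proof.
  intros H1 H2 E0 E1 HB.
  assert (B0 : 0 <= B) by (apply Rle_trans with (2 := HB 0 ltac:(lra)); apply Rabs_pos).
  assert (K : forall t, 0 <= t <= 1 -> Rabs (f1 t) <= B).
  { intros t Ht. destruct (MVT_gen f1 0 t f2) as (c & Hc & Hfc).
    - intros s _; apply H2.
    - intros s _. apply continuity_pt_filterlim.
      apply (ex_derive_continuous f1 s). exists (f2 s); apply H2.
    - rewrite Rmin_left, Rmax_right in Hc by lra.
      replace (f1 t) with (f2 c * t) by lra.
      rewrite Rabs_mult, (Rabs_pos_eq t) by lra.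
      generalize (HB c ltac:(lra)) (Rabs_pos (f2 c)). nra. }
  destruct (MVT_gen f 0 1 f1) as (c & Hc & Hfc).
  - intros s _; apply H1.
  - intros s _. apply continuity_pt_filterlim.
    apply (ex_derive_continuous f s). exists (f1 s); apply H1.
  - rewrite Rmin_left, Rmax_right in Hc by lra.
    replace (f 1) with (f1 c) by lra. apply K; lra.
Qed.

(** Along the segment [t |-> t * w], each component of [Cexp (t w) - 1 - t w]
    vanishes to first order at 0 and has second derivative at most
    [3 |w|^2 e^|w|]. The explicit dependence on [w] is what makes term-by-term
    differentiation of a Dirichlet series uniform. *)
Lemma Cexp_second_order (w : C) :
  Cmod (Cexp w - 1 - w) <= 6 * Cmod w ^ 2 * exp (Cmod w).
Proof.
  destruct w as [x y].
  assert (Hx : Rabs x <= Cmod (x, y)) by (apply Rle_trans with (2 := Rmax_Cmod _); apply Rmax_l).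
  assert (Hy : Rabs y <= Cmod (x, y)) by (apply Rle_trans with (2 := Rmax_Cmod _); apply Rmax_r).
  assert (Hbound : forall t c s, 0 <= t <= 1 -> -1 <= c <= 1 -> -1 <= s <= 1 ->
    Rabs (exp (t * x) * ((x * x - y * y) * c - 2 * x * y * s)) <=
      3 * Cmod (x, y) ^ 2 * exp (Cmod (x, y))).
  { set (r := Cmod (x, y)) in *. assert (Hr : 0 <= r) by apply Cmod_ge_0.
    intros t c s Ht Hc Hs.
    rewrite Rabs_mult, (Rabs_pos_eq (exp _)) by (left; apply exp_pos).
    rewrite Rmult_comm.
    assert (r2 : r ^ 2 = x * x + y * y).
    { unfold r, Cmod. simpl. rewrite !Rmult_1_r, sqrt_sqrt; nra. }
    apply Rmult_le_compat; [apply Rabs_pos | left; apply exp_pos | |].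
    - rewrite r2. unfold Rminus. apply Rle_trans with (1 := Rabs_triang _ _).
      rewrite Rabs_Ropp, !Rabs_mult.
      assert (Rabs c <= 1) by (apply Rabs_le; lra).
      assert (Rabs s <= 1) by (apply Rabs_le; lra).
      assert (Rabs (x * x + - (y * y)) <= x * x + y * y) by (apply Rabs_le; nra).
      rewrite (Rabs_pos_eq 2) by lra.
      assert (2 * Rabs x * Rabs y <= 2 * (x * x + y * y)).
      { rewrite <- (Rabs_pos_eq (x * x)), <- (Rabs_pos_eq (y * y)), !Rabs_mult by nra.
        nra. }
      generalize (Rabs_pos (x * x + - (y * y))) (Rabs_pos c) (Rabs_pos s)
        (Rabs_pos x) (Rabs_pos y). intros.
      assert (0 <= 2 * Rabs x * Rabs y) by nra. nra.
    - destruct (Rle_lt_or_eq_dec (t * x) r) as [H| ->]; [|left; apply exp_increasing; exact H|lra].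
      apply Rabs_le_between in Hx. nra. }
  assert (R1 : Rabs (exp (1 * x) * cos (1 * y) - 1 - 1 * x) <=
     3 * Cmod (x, y) ^ 2 * exp (Cmod (x, y))).
  { apply (second_order_remainder (fun t => exp (t * x) * cos (t * y) - 1 - t * x)
      (fun t => exp (t * x) * (x * cos (t * y) - y * sin (t * y)) - x)
      (fun t => exp (t * x) * ((x * x - y * y) * cos (t * y) - 2 * x * y * sin (t * y)))).
    - intros t. auto_derive; [trivial | ring].
    - intros t. auto_derive; [trivial | ring].
    - rewrite !Rmult_0_l, exp_0, cos_0. ring.
    - rewrite !Rmult_0_l, exp_0, cos_0, sin_0. ring.
    - intros t Ht. apply Hbound; [exact Ht | apply COS_bound | apply SIN_bound]. }
  assert (R2 : Rabs (exp (1 * x) * sin (1 * y) - 1 * y) <=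
     3 * Cmod (x, y) ^ 2 * exp (Cmod (x, y))).
  { apply (second_order_remainder (fun t => exp (t * x) * sin (t * y) - t * y)
      (fun t => exp (t * x) * (x * sin (t * y) + y * cos (t * y)) - y)
      (fun t => exp (t * x) * ((x * x - y * y) * sin (t * y) - 2 * x * y * - cos (t * y)))).
    - intros t. auto_derive; [trivial | ring].
    - intros t. auto_derive; [trivial | ring].
    - rewrite !Rmult_0_l, sin_0. ring.
    - rewrite !Rmult_0_l, exp_0, cos_0, sin_0. ring.
    - intros t Ht. apply Hbound; [exact Ht | apply SIN_bound |].
      generalize (COS_bound (t * y)); lra. }
  rewrite !Rmult_1_l in R1, R2.
  set (B := 3 * Cmod (x, y) ^ 2 * exp (Cmod (x, y))) in *.
  replace (6 * _ * _) with (B + B) by (unfold B; ring).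
  apply Rle_trans with (1 := Cmod_le_Re_Im _).
  apply Rplus_le_compat; [apply Rle_trans with (2 := R1) | apply Rle_trans with (2 := R2)];
  right; f_equal; simpl; ring.
Qed.

Lemma is_derive_Cexp (z : C) : @is_derive C_AbsRing C_NormedModule Cexp z (Cexp z).
Proof.
  apply is_derive_C_epsilon. intros eps.
  set (B := 6 * exp 1 * exp (Re z)).
  assert (HB : 0 < B) by (unfold B; generalize (exp_pos 1) (exp_pos (Re z)); nra).
  assert (Hd : 0 < Rmin 1 (eps / B)).
  { apply Rmin_glb_lt; [lra | apply Rdiv_lt_0_compat; [apply eps | exact HB]]. }
  exists (mkposreal _ Hd). simpl. intros w Hw.
  generalize (Rmin_l 1 (eps / B)) (Rmin_r 1 (eps / B)); intros L1 L2.
  assert (E : (Cexp w - Cexp z - (w - z) * Cexp z)%C =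
              (Cexp z * (Cexp (w - z) - 1 - (w - z)))%C).
  { replace (Cexp w) with (Cexp z * Cexp (w - z))%C.
    - ring.
    - rewrite <- Cexp_plus. f_equal. ring. }
  rewrite E, Cmod_mult, Cmod_Cexp.
  set (v := (w - z)%C) in *. generalize (Cexp_second_order v) (Cmod_ge_0 v). intros H0 Hv.
  assert (He : exp (Cmod v) <= exp 1).
  { left. apply exp_increasing. lra. }
  assert (HvB : Cmod v * B <= eps).
  { apply Rle_trans with (eps / B * B); [nra | right; field; lra]. }
  apply Rle_trans with (exp (Re z) * (6 * Cmod v ^ 2 * exp 1)).
  - apply Rmult_le_compat_l; [left; apply exp_pos|].
    apply Rle_trans with (1 := H0). apply Rmult_le_compat_l; [nra | exact He].
  - replace (exp (Re z) * (6 * Cmod v ^ 2 * exp 1)) with (Cmod v * B * Cmod v)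
      by (unfold B; ring).
    apply Rmult_le_compat_r; assumption.
Qed.

(** * Means over circles *)

(** [M] near [c] in the logarithmic polar coordinate [z = ln rho + i theta],
    divided by [(e^z)^m]: its mean over a period in [theta] is the [m]-th
    Laurent coefficient of [M] at [c]. *)
Definition polar_laurent (M : C -> C) (c : R) (m : nat) (z : C) : C :=
  (M (RtoC c + Cexp z) * Cexp (RtoC (- INR m) * z))%C.

Lemma ex_derive_polar_laurent M c m z :
  @ex_derive C_AbsRing C_NormedModule M (RtoC c + Cexp z)%C ->
  @ex_derive C_AbsRing C_NormedModule (polar_laurent M c m) z.
Proof.
  intros [l Hl]. eexists. unfold polar_laurent. apply is_derive_mult_C.
  - apply (is_derive_comp_C (fun w => M (RtoC c + w)%C) Cexp); [|apply is_derive_Cexp].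
    apply (is_derive_comp_C M (fun w => RtoC c + w)%C); [exact Hl|].
    apply (is_derive_ext (K := C_AbsRing) (V := C_NormedModule) (fun w => RtoC c + RtoC 1 * w)%C).
    + intros w. apply f_equal, Cmult_1_l.
    + apply is_derive_affine_C.
  - apply (is_derive_comp_C Cexp (fun w => RtoC (- INR m) * w)%C); [apply is_derive_Cexp|].
    apply (is_derive_ext (K := C_AbsRing) (V := C_NormedModule)
      (fun w => RtoC 0 + RtoC (- INR m) * w)%C).
    + intros w. apply Cplus_0_l.
    + apply is_derive_affine_C.
Qed.

Lemma Cexp_period (x y : R) (k : nat) : Cexp (x, y + 2 * INR k * PI) = Cexp (x, y).
Proof. unfold Cexp; simpl. rewrite cos_period, sin_period. reflexivity. Qed.

Lemma polar_laurent_period M c m x :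
  polar_laurent M c m (x, 0 + 2 * PI) = polar_laurent M c m (x, 0).
Proof.
  unfold polar_laurent. f_equal.
  - f_equal. f_equal. rewrite <- (Cexp_period x 0 1). f_equal. simpl. f_equal. ring.
  - transitivity (Cexp (- INR m * x, - INR m * (2 * PI))).
    + f_equal. apply injective_projections; simpl; ring.
    + rewrite <- (Cexp_period _ _ m). f_equal. apply injective_projections; simpl; ring.
Qed.

Lemma disk_in_half_plane r c x y :
  exp x < c - r -> right_half_plane r (RtoC c + Cexp (x, y))%C.
Proof.
  intros Hx. unfold right_half_plane. simpl.
  generalize (COS_bound y) (exp_pos x). nra.
Qed.

Lemma polar_laurent_closed_form M r c m x y :
  holomorphic_on (right_half_plane r) M -> exp x < c - r ->
  closed_form_at (fun s t => Im (polar_laurent M c m (s, t)))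
                 (fun s t => Re (polar_laurent M c m (s, t))) x y.
Proof.
  intros HM Hx. apply cauchy_riemann_closed_form, ex_derive_polar_laurent, HM.
  apply disk_in_half_plane. exact Hx.
Qed.

Lemma polar_laurent_continuous M r c m x t :
  holomorphic_on (right_half_plane r) M -> exp x < c - r ->
  continuous (fun u => Re (polar_laurent M c m (x, u))) t /\
  continuous (fun u => Im (polar_laurent M c m (x, u))) t.
Proof.
  intros HM Hx.
  destruct (polar_laurent_closed_form M r c m x t HM Hx) as (a & b & d & Hp & Hq).
  apply differentiable_pt_lim_continuous in Hp. apply differentiable_pt_lim_continuous in Hq.
  split; [apply Hq | apply Hp].
Qed.

(** Real part of [2 pi] times the [m]-th Laurent coefficient of [M] at [c],
    computed on the circle of radius [exp x]. *)
Definition circle_mean (M : C -> C) (c : R) (m : nat) (x : R) : R :=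
  RInt (fun t => Re (polar_laurent M c m (x, t))) 0 (2 * PI).

Lemma ex_RInt_polar_laurent M r c m x :
  holomorphic_on (right_half_plane r) M -> exp x < c - r ->
  ex_RInt (fun t => Re (polar_laurent M c m (x, t))) 0 (2 * PI).
Proof.
  intros HM Hx. apply (ex_RInt_continuous (V := R_CompleteNormedModule)). intros t _.
  exact (proj1 (polar_laurent_continuous M r c m x t HM Hx)).
Qed.

(** On a rectangle of height [2 pi] the two horizontal edges cancel by
    periodicity, so a zero circulation says that the vertical edges agree. *)
Lemma circle_mean_invariant M r c m x1 x2 :
  holomorphic_on (right_half_plane r) M -> x1 <= x2 -> exp x2 < c - r ->
  circle_mean M c m x1 = circle_mean M c m x2.
Proof.
  intros HM H12 H2. assert (HPI := PI_RGT_0).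
  assert (Hexp : forall x, x <= x2 -> exp x < c - r).
  { intros x [Hx| ->]; [|exact H2].
    apply Rlt_trans with (2 := H2). apply exp_increasing. exact Hx. }
  assert (H0 := circulation_closed_form
    (fun s t => Im (polar_laurent M c m (s, t)))
    (fun s t => Re (polar_laurent M c m (s, t))) x1 (x2 - x1) 0 (2 * PI)
    ltac:(intros s t Hs Ht; apply (polar_laurent_closed_form M r); [exact HM | apply Hexp; lra])
    ltac:(lra) ltac:(lra)).
  unfold circulation in H0. cbv beta in H0.
  rewrite (RInt_ext (fun t => Im (polar_laurent M c m (t, 0)) -
     Im (polar_laurent M c m (t, 0 + 2 * PI))) (fun _ => 0)) in H0.
  2: { intros t _. rewrite polar_laurent_period. apply Rminus_diag. }
  rewrite RInt_const in H0. unfold scal in H0; simpl in H0; unfold mult in H0; simpl in H0.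
  rewrite Rmult_0_r, !Rplus_0_l in H0.
  replace (x1 + (x2 - x1)) with x2 in H0 by ring.
  rewrite (RInt_minus (V := R_CompleteNormedModule)
     (fun t => Re (polar_laurent M c m (x2, t))) (fun t => Re (polar_laurent M c m (x1, t)))) in H0.
  - change (circle_mean M c m x2 - circle_mean M c m x1 = 0) in H0. lra.
  - apply (ex_RInt_polar_laurent M r); [exact HM | apply Hexp; lra].
  - apply (ex_RInt_polar_laurent M r); [exact HM | apply Hexp; lra].
Qed.

(** Cauchy's estimate: the constant is uniform in [m], because [m] only enters
    through a factor of modulus [exp (- m x)]. *)
Lemma circle_mean_bound M r c x :
  holomorphic_on (right_half_plane r) M -> exp x < c - r ->
  exists B, 0 <= B /\ forall m, Rabs (circle_mean M c m x) <= B * exp (- INR m * x).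
Proof.
  intros HM Hx. assert (HPI := PI_RGT_0).
  set (N := fun t => Rabs (Re (polar_laurent M c 0 (x, t))) + Rabs (Im (polar_laurent M c 0 (x, t)))).
  assert (HN : ex_RInt N 0 (2 * PI)).
  { apply (ex_RInt_continuous (V := R_CompleteNormedModule)). intros t _.
    destruct (polar_laurent_continuous M r c 0 x t HM Hx) as [H1 H2].
    apply (continuous_plus (V := R_NormedModule));
    apply (continuous_comp _ Rabs); auto; apply continuous_Rabs. }
  exists (RInt N 0 (2 * PI)). split.
  { apply RInt_ge_0; [lra | exact HN |]. intros t _.
    apply Rplus_le_le_0_compat; apply Rabs_pos. }
  intros m.
  assert (HS : ex_RInt (fun t => exp (- INR m * x) * N t) 0 (2 * PI)).
  { apply (ex_RInt_scal (V := R_NormedModule)). exact HN. }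
  replace (RInt N 0 (2 * PI) * exp (- INR m * x)) with
    (RInt (fun t => exp (- INR m * x) * N t) 0 (2 * PI)).
  2: { rewrite (RInt_scal (V := R_CompleteNormedModule)) by exact HN.
       unfold scal; simpl; unfold mult; simpl. ring. }
  unfold circle_mean.
  apply (norm_RInt_le (V := R_NormedModule) (fun t => Re (polar_laurent M c m (x, t)))
    (fun t => exp (- INR m * x) * N t) 0 (2 * PI)); [lra | | |].
  - intros t _.
    apply Rle_trans with (Cmod (polar_laurent M c m (x, t))); [apply re_le_Cmod|].
    unfold polar_laurent. rewrite Cmod_mult, Cmod_Cexp.
    rewrite Rmult_comm. replace (Re (RtoC (- INR m) * (x, t))%C) with (- INR m * x)
      by (simpl; ring).
    apply Rmult_le_compat_l; [left; apply exp_pos|].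
    unfold N, polar_laurent.
    replace (RtoC (- INR 0) * (x, t))%C with (RtoC 0)
      by (apply injective_projections; simpl; ring).
    rewrite Cexp_0, Cmult_1_r. apply Cmod_le_Re_Im.
  - apply (RInt_correct (V := R_CompleteNormedModule)).
    apply (ex_RInt_polar_laurent M r); assumption.
  - apply (RInt_correct (V := R_CompleteNormedModule)). exact HS.
Qed.

(** * Circle means of exponentials *)

(** Real part of [exp (lambda e^(i t)) e^(- i nu t)]. *)
Definition exp_circle_integrand (nu lambda t : R) : R :=
  exp (lambda * cos t) * cos (lambda * sin t - nu * t).

Definition exp_circle_mean (nu lambda : R) : R :=
  RInt (exp_circle_integrand nu lambda) 0 (2 * PI).

Lemma exp_circle_integrand_continuous nu lambda t :
  continuous (exp_circle_integrand nu lambda) t.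
Proof.
  apply (ex_derive_continuous (K := R_AbsRing) (V := R_NormedModule)).
  unfold exp_circle_integrand. auto_derive. trivial.
Qed.

Lemma ex_RInt_exp_circle nu lambda : ex_RInt (exp_circle_integrand nu lambda) 0 (2 * PI).
Proof.
  apply (ex_RInt_continuous (V := R_CompleteNormedModule)).
  intros t _. apply exp_circle_integrand_continuous.
Qed.

(** The difference of the two sides is the integral over a period of the
    derivative of [exp (lambda cos t) sin (lambda sin t - m t)]. *)
Lemma exp_circle_mean_recurrence (m : nat) lambda :
  lambda * exp_circle_mean (INR m - 1) lambda = INR m * exp_circle_mean (INR m) lambda.
Proof.
  set (F := fun t => exp (lambda * cos t) * sin (lambda * sin t - INR m * t)).
  set (dF := fun t => lambda * exp_circle_integrand (INR m - 1) lambda t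
                      - INR m * exp_circle_integrand (INR m) lambda t).
  assert (H : is_RInt dF 0 (2 * PI) (minus (F (2 * PI)) (F 0))).
  { apply (is_RInt_derive (V := R_CompleteNormedModule)).
    - intros t _. unfold F, dF, exp_circle_integrand. auto_derive; [trivial|].
      replace (lambda * sin t - (INR m - 1) * t) with ((lambda * sin t - INR m * t) + t) by ring.
      rewrite (cos_plus (lambda * sin t - INR m * t) t). unfold Rminus. ring.
    - intros t _. apply (continuous_minus (V := R_NormedModule));
      apply (continuous_scal_r (K := R_AbsRing) (V := R_NormedModule));
      apply exp_circle_integrand_continuous. }
  assert (E : minus (F (2 * PI)) (F 0) = 0).
  { unfold F. rewrite cos_2PI, sin_2PI, cos_0, sin_0.
    replace (lambda * 0 - INR m * (2 * PI)) with (- (0 + 2 * INR m * PI)) by ring.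
    rewrite sin_neg, sin_period, !Rmult_0_r, Rminus_0_r, sin_0.
    unfold minus, plus, opp; simpl. ring. }
  rewrite E in H. apply (is_RInt_unique (V := R_CompleteNormedModule)) in H. unfold dF in H.
  rewrite (RInt_minus (V := R_CompleteNormedModule)
    (fun t => lambda * exp_circle_integrand (INR m - 1) lambda t)
    (fun t => INR m * exp_circle_integrand (INR m) lambda t)) in H.
  2, 3: apply (ex_RInt_scal (V := R_NormedModule)); apply ex_RInt_exp_circle.
  rewrite (RInt_scal (V := R_CompleteNormedModule)
    (exp_circle_integrand (INR m - 1) lambda)) in H by apply ex_RInt_exp_circle.
  rewrite (RInt_scal (V := R_CompleteNormedModule)
    (exp_circle_integrand (INR m) lambda)) in H by apply ex_RInt_exp_circle.
  change (lambda * exp_circle_mean (INR m - 1) lambda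
          - INR m * exp_circle_mean (INR m) lambda = 0) in H.
  lra.
Qed.

Lemma is_derive_exp_circle_mean_0 lambda :
  is_derive (exp_circle_mean 0) lambda (exp_circle_mean (-1) lambda).
Proof.
  assert (D : forall u t, is_derive (fun z => exp_circle_integrand 0 z t) u
                            (exp_circle_integrand (-1) u t)).
  { intros u t. unfold exp_circle_integrand. auto_derive; [trivial|].
    rewrite Rmult_0_l, !Ropp_0, !Rplus_0_r.
    replace (u * sin t - -1 * t) with (u * sin t + t) by ring.
    rewrite (cos_plus (u * sin t) t). ring. }
  unfold exp_circle_mean.
  rewrite (RInt_ext (exp_circle_integrand (-1) lambda)
            (fun t => Derive (fun u => exp_circle_integrand 0 u t) lambda)).
  2: { intros t _. symmetry. apply is_derive_unique, D. }
  apply (is_derive_RInt_param (fun u t => exp_circle_integrand 0 u t)).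
  - apply filter_forall. intros u t _. exists (exp_circle_integrand (-1) u t). apply D.
  - intros t _. apply continuity_2d_pt_ext with (fun u v => exp_circle_integrand (-1) u v).
    { intros u v. symmetry. apply is_derive_unique, D. }
    unfold exp_circle_integrand.
    assert (C1 : forall x y, continuity_2d_pt (fun u v => cos v) x y).
    { intros x y. apply (continuity_1d_2d_pt_comp cos (fun u v => v));
      [apply continuity_cos | apply continuity_2d_pt_id2]. }
    assert (C2 : forall x y, continuity_2d_pt (fun u v => sin v) x y).
    { intros x y. apply (continuity_1d_2d_pt_comp sin (fun u v => v));
      [apply continuity_sin | apply continuity_2d_pt_id2]. }
    apply continuity_2d_pt_mult.
    + apply (continuity_1d_2d_pt_comp exp (fun u v => u * cos v)).
      * apply derivable_continuous_pt, derivable_pt_exp.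
      * apply continuity_2d_pt_mult; [apply continuity_2d_pt_id1 | apply C1].
    + apply (continuity_1d_2d_pt_comp cos (fun u v => u * sin v - -1 * v)).
      * apply continuity_cos.
      * apply continuity_2d_pt_minus; apply continuity_2d_pt_mult;
        first [apply continuity_2d_pt_id1 | apply C2 | apply continuity_2d_pt_const
              | apply continuity_2d_pt_id2].
  - apply filter_forall. intros u. apply ex_RInt_exp_circle.
Qed.

(** The mean value property of [exp]. The derivative in [lambda] is the mean of
    index [-1], which vanishes: the recurrence at [m = 0] gives this for
    [lambda <> 0], and a direct integration of [cos] for [lambda = 0]. *)
Lemma exp_circle_mean_0 lambda : exp_circle_mean 0 lambda = 2 * PI.
Proof.
  assert (Z0 : exp_circle_mean 0 0 = 2 * PI).
  { unfold exp_circle_mean, exp_circle_integrand.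
    rewrite (RInt_ext _ (fun _ => 1)).
    - rewrite RInt_const. unfold scal; simpl; unfold mult; simpl. ring.
    - intros t _. rewrite !Rmult_0_l, Rminus_0_r, exp_0, cos_0. apply Rmult_1_l. }
  assert (Z1 : forall u, u * exp_circle_mean (-1) u = 0).
  { intros u. generalize (exp_circle_mean_recurrence 0 u). simpl.
    rewrite Rminus_0_l, Rmult_0_l. exact (fun H => H). }
  destruct (Req_dec lambda 0) as [-> | Hne]; [exact Z0|].
  rewrite <- Z0. symmetry.
  assert (D := is_derive_exp_circle_mean_0).
  assert (Zm : exp_circle_mean (-1) 0 = 0).
  { unfold exp_circle_mean, exp_circle_integrand.
    rewrite (RInt_ext _ cos).
    - rewrite (is_RInt_unique cos 0 (2 * PI) (minus (sin (2 * PI)) (sin 0))).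
      + rewrite sin_2PI, sin_0. apply (minus_eq_zero (G := R_AbelianGroup)).
      + apply (is_RInt_derive (V := R_CompleteNormedModule)).
        * intros t _. auto_derive; [trivial | ring].
        * intros t _. apply continuity_pt_filterlim, continuity_cos.
    - intros t _. rewrite !Rmult_0_l, exp_0.
      replace (0 - -1 * t) with t by ring. apply Rmult_1_l. }
  destruct (MVT_gen (exp_circle_mean 0) 0 lambda (exp_circle_mean (-1))) as (u & _ & Hu).
  - intros u _; apply D.
  - intros u _. apply continuity_pt_filterlim.
    apply (ex_derive_continuous (K := R_AbsRing) (V := R_NormedModule)).
    exists (exp_circle_mean (-1) u); apply D.
  - destruct (Req_dec u 0) as [-> | Hu0].
    + rewrite Zm in Hu. lra.
    + assert (Zu : exp_circle_mean (-1) u = 0).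
      { apply Rmult_eq_reg_l with u; [rewrite Z1; ring | exact Hu0]. }
      rewrite Zu in Hu. lra.
Qed.

(** These are the Taylor coefficients of [exp (lambda z)], times [2 pi]. *)
Lemma exp_circle_mean_nat (m : nat) lambda :
  exp_circle_mean (INR m) lambda = 2 * PI * (lambda ^ m / INR (fact m)).
Proof.
  induction m as [|m IH].
  - simpl. rewrite exp_circle_mean_0. field.
  - assert (H := exp_circle_mean_recurrence (S m) lambda).
    replace (INR (S m) - 1) with (INR m) in H by (rewrite S_INR; ring).
    rewrite IH in H.
    assert (Hm : INR (S m) <> 0) by (apply not_0_INR; discriminate).
    apply Rmult_eq_reg_l with (INR (S m)); [|exact Hm].
    rewrite <- H. rewrite fact_simpl, mult_INR. simpl pow. field.
    split; [apply INR_fact_neq_0 | exact Hm].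
Qed.

(** * Series *)

Lemma is_series_le (u v : nat -> R) (l l' : R) :
  is_series u l -> is_series v l' -> (forall n, u n <= v n) -> l <= l'.
Proof.
  intros Hu Hv H.
  apply (is_lim_seq_le (sum_n u) (sum_n v) l l'); [|exact Hu | exact Hv].
  intros n. apply sum_n_m_le. exact H.
Qed.

Lemma is_series_Rabs_le (u v : nat -> R) (l l' : R) :
  is_series u l -> is_series v l' -> (forall n, Rabs (u n) <= v n) -> Rabs l <= l'.
Proof.
  intros Hu Hv H. apply Rabs_le. split.
  - apply Ropp_le_cancel. rewrite Ropp_involutive.
    apply (is_series_le (fun n => - u n) v); [apply (is_series_opp (V := R_NormedModule) u l Hu) | exact Hv |].
    intros n. generalize (H n). intros K. apply Rabs_le_between in K. lra.
  - apply (is_series_le u v); [exact Hu | exact Hv |].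
    intros n. generalize (H n). intros K. apply Rabs_le_between in K. lra.
Qed.

(** Term-by-term integration under the Weierstrass M-test. *)
Lemma is_series_integral (b : nat -> R -> R) (beta : nat -> R) (F : R -> R) (lo hi : R) :
  (forall n t, continuous (b n) t) -> (forall n t, Rabs (b n t) <= beta n) ->
  ex_series beta -> (forall t, is_series (fun n => b n t) (F t)) ->
  is_series (fun n => RInt (b n) lo hi) (RInt F lo hi).
Proof.
  intros Hc Hb Hbeta HF.
  assert (HI : forall n, ex_RInt (b n) lo hi).
  { intros n. apply (ex_RInt_continuous (V := R_CompleteNormedModule)). intros t _. apply Hc. }
  assert (HS : forall N, is_RInt (fun t => sum_n (fun n => b n t) N) lo hi
                         (sum_n (fun n => RInt (b n) lo hi) N)).
  { induction N as [|N IH].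
    - apply (is_RInt_ext (b O)); [intros t _; symmetry; apply sum_O|].
      rewrite sum_O. apply (RInt_correct (V := R_CompleteNormedModule)), HI.
    - apply (is_RInt_ext (fun t => plus (sum_n (fun n => b n t) N) (b (S N) t)));
        [intros t _; symmetry; apply sum_Sn|].
      rewrite sum_Sn. apply (is_RInt_plus (V := R_NormedModule)); [exact IH|].
      apply (RInt_correct (V := R_CompleteNormedModule)), HI. }
  destruct (filterlim_RInt (V := R_CompleteNormedModule)
     (fun N t => sum_n (fun n => b n t) N) lo hi eventually _ F _ HS) as (l & Hl & HIl).
  - apply filterlim_locally. intros eps.
    destruct Hbeta as [Sb HSb].
    assert (Hev : eventually (fun N => Rabs (sum_n beta N - Sb) < eps)).
    { apply (proj1 (filterlim_locally (U := R_UniformSpace) (sum_n beta) Sb) HSb eps). }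
    apply (fun H => filter_imp _ _ H Hev). intros N HN t.
    change (Rabs (sum_n (fun n => b n t) N - F t) < eps).
    assert (Hcancel : forall x y : R, @plus R_AbelianMonoid (x - y) y = x)
      by (intros x y; unfold plus; simpl; ring).
    assert (Ht : is_series (fun k => b (S N + k)%nat t) (F t - sum_n (fun n => b n t) N)).
    { generalize (is_series_incr_n (fun n => b n t) (S N) (F t - sum_n (fun n => b n t) N)).
      intros K. apply K; [lia|]. simpl pred.
      rewrite Hcancel. apply HF. }
    assert (Hbt : is_series (fun k => beta (S N + k)%nat) (Sb - sum_n beta N)).
    { apply is_series_incr_n; [lia|]. simpl pred.
      rewrite Hcancel. exact HSb. }
    rewrite Rabs_minus_sym. rewrite Rabs_minus_sym in HN.
    apply Rle_lt_trans with (2 := Rle_lt_trans _ _ _ (Rle_abs _) HN).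
    apply (is_series_Rabs_le _ _ _ _ Ht Hbt). intros k. apply Hb.
  - rewrite (is_RInt_unique _ _ _ _ HIl). exact Hl.
Qed.

Lemma sum_n_le_series (u : nat -> R) (l : R) (N : nat) :
  is_series u l -> (forall n, (N < n)%nat -> 0 <= u n) -> sum_n u N <= l.
Proof.
  intros Hu Hpos.
  apply (is_lim_seq_le_loc (fun _ => sum_n u N) (sum_n u) (sum_n u N) l);
    [|apply is_lim_seq_const | exact Hu].
  exists N. intros n Hn. induction Hn as [|n Hn IH]; [apply Rle_refl|].
  rewrite sum_Sn. unfold plus; simpl. generalize (Hpos (S n) ltac:(lia)). lra.
Qed.

Lemma is_series_sum_n (u : nat -> nat -> R) (l : nat -> R) (N : nat) :
  (forall n, is_series (u n) (l n)) ->
  is_series (fun m => sum_n (fun n => u n m) N) (sum_n l N).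
Proof.
  intros H. induction N as [|N IH].
  - rewrite sum_O. apply (is_series_ext (u O)); [intros m; rewrite sum_O; reflexivity | apply H].
  - rewrite sum_Sn. apply (is_series_ext (fun m => plus (sum_n (fun n => u n m) N) (u (S N) m))).
    + intros m. rewrite sum_Sn. reflexivity.
    + apply (is_series_plus (V := R_NormedModule)); [exact IH | apply H].
Qed.

Lemma ex_series_bounded (u : nat -> R) (N : nat) (B : R) :
  (forall n, (N < n)%nat -> 0 <= u n) -> (forall n, (N <= n)%nat -> sum_n u n <= B) ->
  ex_series u.
Proof.
  intros Hpos HB.
  destruct (ex_finite_lim_seq_incr (fun n => sum_n u (n + N)) B) as [l Hl].
  - intros n. simpl. rewrite sum_Sn. unfold plus; simpl.
    generalize (Hpos (S (n + N)) ltac:(lia)). lra.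
  - intros n. apply HB. lia.
  - exists l. apply (is_lim_seq_incr_n (sum_n u) N l). exact Hl.
Qed.

Lemma ex_series_eventually_eq (u v : nat -> R) (N : nat) :
  (forall n, (N <= n)%nat -> u n = v n) -> ex_series u -> ex_series v.
Proof.
  intros H Hu. apply (ex_series_incr_n v N).
  apply (ex_series_ext (fun k => u (N + k)%nat)); [intros k; apply H; lia|].
  apply (ex_series_incr_n u N). exact Hu.
Qed.

(** The continuous real-linear forms on [C] are the maps [z |-> Re (z * w)];
    this one device serves to extract the real part of a rotated series and,
    with [w] the conjugate of the sum, to bound the modulus of a sum. *)
Lemma is_series_C_Re_mult (u : nat -> C) (l w : C) :
  @is_series C_AbsRing C_NormedModule u l ->
  is_series (fun n => Re (u n * w)%C) (Re (l * w)%C).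
Proof.
  intros H.
  assert (Hc : continuous (fun z : C_UniformSpace => Re (z * w)%C) l).
  { change (continuous (fun z : R * R => fst z * fst w - snd z * snd w) l).
    apply (continuous_minus (V := R_NormedModule));
    apply (continuous_mult (K := R_AbsRing)).
    - destruct l; apply continuous_fst.
    - apply continuous_const.
    - destruct l; apply continuous_snd.
    - apply continuous_const. }
  assert (E : forall N, sum_n (fun n => Re (u n * w)%C) N = Re (sum_n u N * w)%C).
  { induction N as [|N IH].
    - rewrite !sum_O. reflexivity.
    - rewrite !sum_Sn, IH. unfold plus; simpl. unfold Cplus; simpl. ring. }
  unfold is_series.
  apply (filterlim_ext (fun N => Re (sum_n u N * w)%C)); [intros N; symmetry; apply E|].
  exact (filterlim_comp _ _ _ (sum_n u) (fun z : C => Re (z * w)%C) _ _ _ H Hc).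
Qed.

Lemma is_series_C_components (u : nat -> C) (l1 l2 : R) :
  is_series (fun n => Re (u n)) l1 -> is_series (fun n => Im (u n)) l2 ->
  @is_series C_AbsRing C_NormedModule u (l1, l2).
Proof.
  intros H1 H2.
  assert (E : forall N, sum_n u N = (sum_n (fun n => Re (u n)) N, sum_n (fun n => Im (u n)) N)).
  { induction N as [|N IH].
    - rewrite !sum_O. apply surjective_pairing.
    - rewrite !sum_Sn, IH. reflexivity. }
  apply (proj2 (filterlim_locally (U := C_UniformSpace) (sum_n u) (l1, l2))). intros eps.
  assert (K1 := proj1 (filterlim_locally (U := R_UniformSpace) _ l1) H1 eps).
  assert (K2 := proj1 (filterlim_locally (U := R_UniformSpace) _ l2) H2 eps).
  apply (fun H => filter_imp _ _ H (filter_and _ _ K1 K2)).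
  intros N HN. rewrite E. exact HN.
Qed.

Lemma is_series_ge_0 (v : nat -> R) (l : R) :
  is_series v l -> (forall n, 0 <= v n) -> 0 <= l.
Proof.
  intros Hv H. apply Rle_trans with (1 := H O). rewrite <- (sum_O v).
  apply sum_n_le_series; [exact Hv | intros n _; apply H].
Qed.

Lemma is_series_Cmod_le (u : nat -> C) (v : nat -> R) (l : C) (l' : R) :
  @is_series C_AbsRing C_NormedModule u l -> is_series v l' ->
  (forall n, Cmod (u n) <= v n) -> Cmod l <= l'.
Proof.
  intros Hu Hv H.
  assert (L0 : 0 <= l').
  { apply (is_series_ge_0 v); [exact Hv|].
    intros n. apply Rle_trans with (2 := H n). apply Cmod_ge_0. }
  destruct (Req_dec (Cmod l) 0) as [-> | Hl]; [exact L0|].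
  assert (Hpos : 0 < Cmod l) by (generalize (Cmod_ge_0 l); lra).
  apply Rmult_le_reg_r with (1 := Hpos).
  assert (E : Re (l * Cconj l)%C = Cmod l * Cmod l).
  { rewrite <- Cmod2_conj. simpl. ring. }
  rewrite <- E. apply Rle_trans with (1 := Rle_abs _).
  apply (is_series_Rabs_le (fun n => Re (u n * Cconj l)%C) (fun n => Cmod l * v n)).
  - apply is_series_C_Re_mult. exact Hu.
  - rewrite Rmult_comm. apply (is_series_scal (V := R_NormedModule) (Cmod l) v l' Hv).
  - intros n. apply Rle_trans with (1 := re_le_Cmod _).
    rewrite Cmod_mult, Cmod_conj, Rmult_comm. apply Rmult_le_compat_l; [lra | apply H].
Qed.

Lemma is_series_C_of_abs (u : nat -> C) (v : nat -> R) :
  ex_series v -> (forall n, Cmod (u n) <= v n) ->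
  @is_series C_AbsRing C_NormedModule u
    (Series (fun n => Re (u n)), Series (fun n => Im (u n))).
Proof.
  intros Hv H. apply is_series_C_components; apply Series_correct;
  apply (ex_series_le (V := R_CompleteNormedModule) _ v); try exact Hv; intros n;
  apply Rle_trans with (2 := H n); apply Rle_trans with (2 := Rmax_Cmod _);
  [apply Rmax_l | apply Rmax_r].
Qed.

(** * Landau theorem *)

Lemma Cdiv_nat_Cpow (x : R) (n : nat) (s : C) :
  Cdiv (RtoC x) (nat_Cpow n s) = (RtoC x * Cexp (- s * RtoC (ln (INR n))))%C.
Proof.
  unfold Cdiv, nat_Cpow. f_equal.
  set (z := (s * RtoC (ln (INR n)))%C).
  replace (- s * RtoC (ln (INR n)))%C with (- z)%C by (unfold z; ring).
  assert (E : (Cexp (- z) * Cexp z)%C = RtoC 1).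
  { rewrite <- Cexp_plus. replace (- z + z)%C with (RtoC 0) by ring. apply Cexp_0. }
  assert (Hz : Cexp z <> RtoC 0).
  { apply Cmod_gt_0. rewrite Cmod_Cexp. apply exp_pos. }
  rewrite <- (Cmult_1_l (/ Cexp z)), <- E. field. exact Hz.
Qed.

Lemma is_dirichlet_series_Re (a : nat -> R) (s l w : C) :
  is_dirichlet_series a s l ->
  is_series (fun n => Re (RtoC (a (S n)) * Cexp (- s * RtoC (ln (INR (S n)))) * w)%C)
            (Re (l * w)%C).
Proof.
  intros H. apply (is_series_ext (fun n => Re (Cdiv (RtoC (a (S n))) (nat_Cpow (S n) s) * w)%C)).
  - intros n. rewrite Cdiv_nat_Cpow. reflexivity.
  - apply is_series_C_Re_mult. exact H.
Qed.

Lemma is_dirichlet_series_real (a : nat -> R) (sigma : R) (l : C) :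
  is_dirichlet_series a (RtoC sigma) l ->
  is_series (fun n => a (S n) * Rpower (INR (S n)) (- sigma)) (Re l).
Proof.
  intros H. apply (is_dirichlet_series_Re a _ _ (RtoC 1)) in H.
  rewrite Cmult_1_r in H. revert H. apply is_series_ext. intros n.
  rewrite Cmult_1_r. unfold Rpower.
  replace (- RtoC sigma * RtoC (ln (INR (S n))))%C with (RtoC (- sigma * ln (INR (S n))))
    by (apply injective_projections; simpl; ring).
  unfold Cexp, RtoC; simpl Re; simpl Im. rewrite cos_0, sin_0.
  unfold Cmult, Re; simpl. ring.
Qed.

Lemma ln_INR_S_ge_0 n : 0 <= ln (INR (S n)).
Proof.
  rewrite <- ln_1. apply ln_le; [lra|]. rewrite S_INR. generalize (pos_INR n). lra.
Qed.

(** The circle of radius 1 around [c] lies in the half-plane where the series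
    represents [M], and there [n^(-s)] is at most [n^(-(c - 1))] in modulus; the
    sum may thus be integrated term by term. *)
Lemma circle_mean_dirichlet (a : nat -> R) (M : C -> C) (sigma0 c : R) (m : nat) :
  (forall s, right_half_plane sigma0 s -> is_dirichlet_series a s (M s)) ->
  sigma0 < c - 1 ->
  ex_series (fun n => Rabs (a (S n)) * Rpower (INR (S n)) (- (c - 1))) ->
  is_series (fun n => a (S n) * Rpower (INR (S n)) (- c) *
               (2 * PI * ((- ln (INR (S n))) ^ m / INR (fact m))))
            (circle_mean M c m 0).
Proof.
  intros HM Hc Habs. unfold circle_mean.
  set (b := fun n t => a (S n) * Rpower (INR (S n)) (- c) *
              exp_circle_integrand (INR m) (- ln (INR (S n))) t).
  apply (is_series_ext (fun n => RInt (b n) 0 (2 * PI))).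
  { intros n. unfold b.
    rewrite (RInt_scal (V := R_CompleteNormedModule)
       (exp_circle_integrand (INR m) (- ln (INR (S n))))) by apply ex_RInt_exp_circle.
    rewrite <- exp_circle_mean_nat. reflexivity. }
  apply (is_series_integral b
    (fun n => Rabs (a (S n)) * Rpower (INR (S n)) (- (c - 1)))).
  - intros n t. unfold b. apply (continuous_scal_r (K := R_AbsRing) (V := R_NormedModule)).
    apply exp_circle_integrand_continuous.
  - intros n t. unfold b, exp_circle_integrand.
    rewrite !Rabs_mult, Rmult_assoc. apply Rmult_le_compat_l; [apply Rabs_pos|].
    rewrite (Rabs_pos_eq (Rpower _ _)), (Rabs_pos_eq (exp _)) by (left; apply exp_pos).
    rewrite <- Rmult_assoc. unfold Rpower. rewrite <- exp_plus.
    rewrite <- (Rmult_1_r (exp (- (c - 1) * _))).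
    apply Rmult_le_compat; [left; apply exp_pos | apply Rabs_pos | |].
    + assert (L := ln_INR_S_ge_0 n). assert (Ct := COS_bound t).
      assert (K : - c * ln (INR (S n)) + - ln (INR (S n)) * cos t <= - (c - 1) * ln (INR (S n)))
        by nra.
      destruct K as [K | ->]; [left; apply exp_increasing; exact K | lra].
    + apply Rabs_le, COS_bound.
  - exact Habs.
  - intros t.
    assert (Hs : right_half_plane sigma0 (RtoC c + Cexp (0, t))%C).
    { apply disk_in_half_plane. rewrite exp_0. lra. }
    assert (H := is_dirichlet_series_Re a _ _ (Cexp (RtoC (- INR m) * (0, t)))%C (HM _ Hs)).
    revert H. apply is_series_ext. intros n. unfold b, exp_circle_integrand, Rpower.
    rewrite <- Cmult_assoc, <- Cexp_plus.
    set (z := (_ + _)%C).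
    replace z with (- c * ln (INR (S n)) + - ln (INR (S n)) * cos t,
                    - ln (INR (S n)) * sin t - INR m * t).
    + unfold Cexp, RtoC; simpl Re; simpl Im. rewrite exp_plus.
      unfold Cmult, Re; simpl. ring.
    + unfold z. apply injective_projections; simpl; rewrite ?exp_0; ring.
Qed.

Lemma is_series_exp (x : R) : is_series (fun m => x ^ m / INR (fact m)) (exp x).
Proof.
  assert (H := is_exp_Reals x). revert H. apply is_series_ext. intros m.
  unfold scal; simpl; unfold mult; simpl. rewrite pow_n_pow. reflexivity.
Qed.

Definition converges_absolutely_beyond (b : nat -> R) (rho : R) : Prop :=
  forall sigma, rho < sigma ->
    ex_series (fun n => Rabs (b (S n)) * Rpower (INR (S n)) (- sigma)).

(** Landau's theorem. With [tau = c - sigma], a radius [rho] between [tau]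
    and [c - r], and [q = tau / rho < 1], the Taylor coefficients at [c]
    satisfy [|A_m| tau^m <= B / (2 pi) q^m]. Adding over [m] bounds the partial
    sums at [sigma], since [n^(-c) e^(tau ln n) = n^(-sigma)]. *)
Lemma landau_absolute_convergence (a : nat -> R) (M : C -> C) (r : R) :
  holomorphic_on (right_half_plane r) M -> extends_dirichlet_series a M ->
  eventually (fun n => 0 <= a n) -> converges_absolutely_beyond a r.
Proof.
  intros Hhol [sigma0 Hser] [N Hpos] sigma Hr.
  assert (HposS : forall n, (N <= n)%nat -> 0 <= a (S n)) by (intros n Hn; apply Hpos; lia).
  assert (Habs : forall s, ex_series (fun n => a (S n) * Rpower (INR (S n)) s) ->
                           ex_series (fun n => Rabs (a (S n)) * Rpower (INR (S n)) s)).
  { intros s. apply ex_series_eventually_eq with N. intros n Hn.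
    rewrite Rabs_pos_eq by (apply HposS; exact Hn). reflexivity. }
  apply Habs.
  (* The unit disk around c stays where the series represents M, and c - sigma
     is at least 2, so that the radius rho is larger than 1. *)
  set (c := Rmax sigma0 sigma + 2).
  generalize (Rmax_l sigma0 sigma) (Rmax_r sigma0 sigma); intros Hc0 Hcs.
  set (tau := c - sigma). set (rho := (tau + (c - r)) / 2).
  assert (Htau : 2 <= tau) by (unfold tau, c; lra).
  assert (Htr : tau < rho < c - r) by (unfold rho, tau; lra).
  assert (Hexp : exp (ln rho) < c - r) by (rewrite exp_ln; lra).
  destruct (circle_mean_bound M r c (ln rho) Hhol Hexp) as (B & HB & Hmean).
  assert (HPI := PI_RGT_0).
  set (q := tau / rho).
  assert (Hq : 0 < q < 1).
  { unfold q. split; [apply Rdiv_lt_0_compat; lra|].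
    apply Rmult_lt_reg_r with rho; [lra|]. unfold Rdiv.
    rewrite Rmult_assoc, Rinv_l; lra. }
  assert (Hconv : ex_series (fun n => Rabs (a (S n)) * Rpower (INR (S n)) (- (c - 1)))).
  { apply Habs. exists (Re (M (RtoC (c - 1)))). apply is_dirichlet_series_real, Hser.
    unfold right_half_plane. simpl. unfold c. lra. }
  set (w := fun m n => (tau * ln (INR (S n))) ^ m / INR (fact m)).
  set (e := fun n => a (S n) * Rpower (INR (S n)) (- c)).
  assert (Hcoef : forall m, exists A, is_series (fun n => e n * w m n) A /\ A <= B / (2 * PI) * q ^ m).
  { intros m.
    exists ((- tau) ^ m / (2 * PI) * circle_mean M c m 0). split.
    - assert (H := circle_mean_dirichlet a M sigma0 c m Hser ltac:(unfold c; lra) Hconv).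
      apply (is_series_scal_l ((- tau) ^ m / (2 * PI))) in H. revert H.
      apply is_series_ext. intros n. unfold e, w.
      unfold scal; simpl; unfold mult; simpl.
      rewrite <- (Rmult_opp_opp tau), Rpow_mult_distr. field.
      split; [apply INR_fact_neq_0 | lra].
    - rewrite (circle_mean_invariant M r c m 0 (ln rho) Hhol); [| |exact Hexp].
      2: { rewrite <- ln_1. apply ln_le; lra. }
      apply Rle_trans with (1 := Rle_abs _). unfold Rdiv.
      rewrite !Rabs_mult, <- RPow_abs, Rabs_Ropp, (Rabs_pos_eq tau), (Rabs_pos_eq (/ (2 * PI)))
        by (try (left; apply Rinv_0_lt_compat); lra).
      assert (Eq : exp (- INR m * ln rho) = / rho ^ m).
      { rewrite <- Rpower_pow by lra. rewrite <- Rpower_Ropp. reflexivity. }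
      assert (Hm := Hmean m). rewrite Eq in Hm.
      unfold q, Rdiv. rewrite Rpow_mult_distr, pow_inv.
      replace (B * / (2 * PI) * (tau ^ m * / rho ^ m)) with
        (tau ^ m * / (2 * PI) * (B * / rho ^ m)) by ring.
      apply Rmult_le_compat_l; [|exact Hm].
      apply Rmult_le_pos; [apply pow_le; lra | left; apply Rinv_0_lt_compat; lra]. }
  (* The terms are nonnegative from N on: truncating the sum over n at K >= N
     can only decrease each coefficient. *)
  apply ex_series_bounded with N (B / (2 * PI) * / (1 - q)).
  { intros n Hn. apply Rmult_le_pos; [apply HposS; lia | left; apply exp_pos]. }
  intros K HK.
  apply (is_series_le (fun m => sum_n (fun n => e n * w m n) K)
                      (fun m => B / (2 * PI) * q ^ m)).
  - apply is_series_sum_n. intros n.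
    replace (a (S n) * Rpower (INR (S n)) (- sigma)) with
      (e n * exp (tau * ln (INR (S n)))).
    + apply (is_series_scal (V := R_NormedModule) (e n) _ _ (is_series_exp _)).
    + unfold e, Rpower. rewrite Rmult_assoc, <- exp_plus. f_equal. f_equal.
      unfold tau. ring.
  - apply (is_series_scal (V := R_NormedModule) (B / (2 * PI)) _ (/ (1 - q))).
    apply is_series_geom.
    rewrite Rabs_pos_eq; lra.
  - intros m. destruct (Hcoef m) as (A & HA & HAle).
    apply Rle_trans with (2 := HAle). apply sum_n_le_series; [exact HA|].
    intros n Hn. unfold e, w. assert (L := ln_INR_S_ge_0 n).
    apply Rmult_le_pos; [apply Rmult_le_pos; [apply HposS; lia | left; apply exp_pos]|].
    apply Rdiv_le_0_compat; [apply pow_le; apply Rmult_le_pos; lra | apply INR_fact_lt_0].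
Qed.

(** * Sum of an absolutely convergent Dirichlet series *)

Definition dirichlet_term (b : nat -> R) (s : C) (n : nat) : C :=
  (RtoC (b (S n)) * Cexp (- s * RtoC (ln (INR (S n)))))%C.

Definition dirichlet_sum (b : nat -> R) (s : C) : C :=
  (Series (fun n => Re (dirichlet_term b s n)),
   Series (fun n => Im (dirichlet_term b s n))).

Lemma Cmod_dirichlet_term (b : nat -> R) (s : C) (n : nat) :
  Cmod (dirichlet_term b s n) = Rabs (b (S n)) * Rpower (INR (S n)) (- Re s).
Proof.
  unfold dirichlet_term. rewrite Cmod_mult, Cmod_R, Cmod_Cexp. f_equal.
  unfold Rpower. f_equal. unfold Re; simpl. ring.
Qed.

Lemma is_series_dirichlet_sum b rho s :
  converges_absolutely_beyond b rho -> rho < Re s ->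
  @is_series C_AbsRing C_NormedModule (dirichlet_term b s) (dirichlet_sum b s).
Proof.
  intros Hb Hs. apply (is_series_C_of_abs _ _ (Hb (Re s) Hs)).
  intros n. rewrite Cmod_dirichlet_term. apply Rle_refl.
Qed.

(** Absorbs the factors [(ln n)^2] of second derivatives into a small shift of
    the abscissa. *)
Lemma square_le_exp (eta x : R) : 0 < eta -> 0 <= x -> x ^ 2 <= 4 / eta ^ 2 * exp (eta * x).
Proof.
  intros He Hx.
  assert (H : eta * x / 2 <= exp (eta * x / 2)).
  { generalize (exp_ineq1_le (eta * x / 2)). lra. }
  assert (H0 : 0 <= eta * x / 2) by (apply Rmult_le_pos; [nra | lra]).
  assert (H2 : (eta * x / 2) ^ 2 <= exp (eta * x)).
  { replace (eta * x) with (eta * x / 2 + eta * x / 2) at 2 by field.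
    rewrite exp_plus. simpl. rewrite Rmult_1_r. apply Rmult_le_compat; assumption. }
  replace (x ^ 2) with (4 / eta ^ 2 * (eta * x / 2) ^ 2) by (field; lra).
  apply Rmult_le_compat_l; [|exact H2].
  apply Rdiv_le_0_compat; [lra | apply pow_lt; exact He].
Qed.

(** The derivative is the formally differentiated series. By
    [Cexp_second_order] the error of the [n]-th term for an increment [h] is at
    most a constant times [|h|^2] times the [n]-th absolute term at the abscissa
    [Re z - 2 eta], still to the right of [rho]: one [eta] pays for [(ln n)^2],
    the other for [e^(|h| ln n)]. *)
Lemma dirichlet_sum_holomorphic b rho :
  converges_absolutely_beyond b rho -> holomorphic_on (right_half_plane rho) (dirichlet_sum b).
Proof.
  intros Hb z Hz. unfold right_half_plane in Hz.
  set (eta := (Re z - rho) / 3). assert (He : 0 < eta) by (unfold eta; lra).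
  set (L := fun n => ln (INR (S n))).
  assert (HL : forall n, 0 <= L n) by (intros n; apply ln_INR_S_ge_0).
  set (v := fun n => Rabs (b (S n)) * Rpower (INR (S n)) (- (Re z - 2 * eta))).
  assert (Hv : ex_series v) by (apply Hb; unfold eta; lra).
  assert (HS := Series_correct _ Hv). set (V := Series v) in HS.
  assert (Hvpos : forall n, 0 <= v n).
  { intros n. apply Rmult_le_pos; [apply Rabs_pos | left; apply exp_pos]. }
  assert (Hz2 : forall n, Rabs (b (S n)) * Rpower (INR (S n)) (- Re z) * exp (2 * eta * L n) = v n).
  { intros n. unfold v, Rpower. rewrite Rmult_assoc, <- exp_plus. f_equal. f_equal.
    unfold L. ring. }
  set (d := fun n => (RtoC (- L n) * dirichlet_term b z n)%C).
  assert (Hd : @is_series C_AbsRing C_NormedModule d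
                 (Series (fun n => Re (d n)), Series (fun n => Im (d n)))).
  { apply (is_series_C_of_abs d (fun n => / (2 * eta) * v n)).
    - apply (ex_series_scal (V := R_NormedModule) (/ (2 * eta)) v Hv).
    - intros n. unfold d. rewrite Cmod_mult, Cmod_R, Rabs_Ropp, (Rabs_pos_eq _ (HL n)).
      rewrite Cmod_dirichlet_term, <- Hz2.
      assert (K : L n <= / (2 * eta) * exp (2 * eta * L n)).
      { apply Rmult_le_reg_l with (2 * eta); [lra|].
        rewrite <- Rmult_assoc, Rinv_r, Rmult_1_l by lra.
        generalize (exp_ineq1_le (2 * eta * L n)). lra. }
      assert (K0 : 0 <= Rabs (b (S n)) * Rpower (INR (S n)) (- Re z)).
      { apply Rmult_le_pos; [apply Rabs_pos | left; apply exp_pos]. }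
      nra. }
  set (D := (Series (fun n => Re (d n)), Series (fun n => Im (d n)))) in Hd.
  exists D. apply is_derive_C_epsilon. intros eps.
  set (A := 24 / eta ^ 2).
  assert (HA : 0 < A) by (apply Rdiv_lt_0_compat; [lra | apply pow_lt; exact He]).
  assert (HV : 0 <= V) by (apply (is_series_ge_0 v V HS Hvpos)).
  assert (Hdelta : 0 < Rmin eta (eps / (A * V + 1))).
  { apply Rmin_glb_lt; [exact He|]. apply Rdiv_lt_0_compat; [apply eps | nra]. }
  exists (mkposreal _ Hdelta). simpl. intros w Hw.
  generalize (Rmin_l eta (eps / (A * V + 1))) (Rmin_r eta (eps / (A * V + 1))); intros M1 M2.
  set (h := (w - z)%C) in *.
  assert (Hre : Rabs (Re h) < eta).
  { apply Rle_lt_trans with (1 := re_le_Cmod h). lra. }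
  assert (Hw' : rho < Re w).
  { apply Rabs_lt_between in Hre. unfold h in Hre. simpl in Hre. unfold eta in Hre.
    unfold Re in *. lra. }
  assert (Hdiff : @is_series C_AbsRing C_NormedModule
    (fun n => dirichlet_term b w n - dirichlet_term b z n - h * d n)%C
    (dirichlet_sum b w - dirichlet_sum b z - h * D)%C).
  { assert (S1 := is_series_dirichlet_sum b rho w Hb Hw').
    assert (S2 := is_series_dirichlet_sum b rho z Hb Hz).
    exact (is_series_minus (V := C_NormedModule) _ _ _ _
      (is_series_minus (V := C_NormedModule) _ _ _ _ S1 S2)
      (is_series_scal (V := C_NormedModule) h _ _ Hd)). }
  apply Rle_trans with (A * Cmod h ^ 2 * V).
  - apply (is_series_Cmod_le _ (fun n => A * Cmod h ^ 2 * v n) _ _ Hdiff).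
    + apply (is_series_scal (V := R_NormedModule) (A * Cmod h ^ 2) v V HS).
    + intros n.
      set (k := (- h * RtoC (L n))%C).
      assert (E : (dirichlet_term b w n - dirichlet_term b z n - h * d n)%C =
                  (dirichlet_term b z n * (Cexp k - 1 - k))%C).
      { unfold d, dirichlet_term. fold (L n).
        replace (- w * RtoC (L n))%C with (- z * RtoC (L n) + k)%C
          by (unfold k, h; ring).
        rewrite Cexp_plus, RtoC_opp. unfold k. ring. }
      rewrite E, Cmod_mult, Cmod_dirichlet_term, <- Hz2.
      assert (Hk : Cmod k = Cmod h * L n).
      { unfold k. rewrite Cmod_mult, Cmod_opp, Cmod_R, (Rabs_pos_eq _ (HL n)). reflexivity. }
      assert (H1 := Cexp_second_order k). rewrite Hk in H1.
      assert (H2 := square_le_exp eta (L n) He (HL n)).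
      assert (H3 : exp (Cmod h * L n) <= exp (eta * L n)).
      { assert (K : Cmod h * L n <= eta * L n) by (apply Rmult_le_compat_r; [apply HL | lra]).
        destruct K as [K | ->]; [left; apply exp_increasing; exact K | lra]. }
      assert (H4 : Cmod (Cexp k - 1 - k) <= A * Cmod h ^ 2 * exp (2 * eta * L n)).
      { apply Rle_trans with (1 := H1).
        replace (2 * eta * L n) with (eta * L n + eta * L n) by ring. rewrite exp_plus.
        replace (6 * (Cmod h * L n) ^ 2 * exp (Cmod h * L n)) with
          (6 * Cmod h ^ 2 * (L n ^ 2 * exp (Cmod h * L n))) by ring.
        replace (A * Cmod h ^ 2 * (exp (eta * L n) * exp (eta * L n))) with
          (6 * Cmod h ^ 2 * (4 / eta ^ 2 * exp (eta * L n) * exp (eta * L n)))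
          by (unfold A; field; lra).
        apply Rmult_le_compat_l; [generalize (pow2_ge_0 (Cmod h)); lra|].
        apply Rmult_le_compat; [apply pow2_ge_0 | left; apply exp_pos | exact H2 | exact H3]. }
      replace (A * Cmod h ^ 2 * (Rabs (b (S n)) * Rpower (INR (S n)) (- Re z) * exp (2 * eta * L n)))
        with (Rabs (b (S n)) * Rpower (INR (S n)) (- Re z) *
              (A * Cmod h ^ 2 * exp (2 * eta * L n))) by ring.
      apply Rmult_le_compat_l; [|exact H4].
      apply Rmult_le_pos; [apply Rabs_pos | left; apply exp_pos].
  - replace (A * Cmod h ^ 2 * V) with (Cmod h * (A * V) * Cmod h) by ring.
    assert (Hh := Cmod_ge_0 h).
    apply Rmult_le_compat_r; [exact Hh|].
    apply Rle_trans with (eps / (A * V + 1) * (A * V + 1)).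
    + apply Rmult_le_compat; [exact Hh | nra | lra | lra].
    + right. field. nra.
Qed.

(** * Connectedness of half-planes *)

Lemma right_half_plane_open rho : open (right_half_plane rho).
Proof.
  intros z Hz. unfold right_half_plane in *.
  assert (He : 0 < Re z - rho) by lra.
  exists (mkposreal _ He). intros y [Hy _]. simpl in Hy.
  assert (Hy' : Rabs (Re y - Re z) < Re z - rho) by exact Hy.
  apply Rabs_lt_between in Hy'. lra.
Qed.

(** Let [T] be the supremum of the parameters at which [A] is met. Openness of
    [A] forbids that [gamma T] is in [A] unless [T = 1]; if [gamma T] is in [B],
    openness of [B] gives points of [A] just before [T] that are also in [B]. *)
Lemma segment_connected (gamma : R -> C) (A B : C -> Prop) :
  (forall t, continuous (U := C_UniformSpace) gamma t) ->
  (forall t, 0 <= t <= 1 -> A (gamma t) \/ B (gamma t)) ->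
  open A -> open B -> A (gamma 0) -> B (gamma 1) ->
  exists t, 0 <= t <= 1 /\ A (gamma t) /\ B (gamma t).
Proof.
  intros Hc Hcov HA HB H0 H1.
  destruct (completeness (fun t => 0 <= t <= 1 /\ A (gamma t))) as [T [Hub Hlub]].
  - exists 1. intros t [Ht _]. lra.
  - exists 0. split; [lra | exact H0].
  - assert (HT0 : 0 <= T) by (apply Hub; split; [lra | exact H0]).
    assert (HT1 : T <= 1) by (apply Hlub; intros t [Ht _]; lra).
    destruct (Hcov T ltac:(lra)) as [HAT | HBT].
    + destruct (Req_dec T 1) as [-> | HT]; [exists 1; split; [lra | split; assumption]|].
      destruct (Hc T A (HA _ HAT)) as [d Hd]. exfalso.
      set (t := Rmin (T + d / 2) 1).
      assert (Hdp := cond_pos d).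
      assert (Ht : T < t <= T + d / 2 /\ t <= 1).
      { unfold t. repeat split; [apply Rmin_glb_lt; lra | apply Rmin_l | apply Rmin_r]. }
      assert (Hle : t <= T).
      { apply Hub. split; [lra|]. apply Hd.
        change (Rabs (t - T) < d). rewrite Rabs_pos_eq; lra. }
      lra.
    + destruct (Hc T B (HB _ HBT)) as [d Hd].
      destruct (classic (exists t, (0 <= t <= 1 /\ A (gamma t)) /\ T - d < t)) as [[t [[Ht HAt] Hlt]] | Hno].
      * assert (t <= T) by (apply Hub; split; assumption).
        exists t. split; [exact Ht|]. split; [exact HAt|]. apply Hd.
        change (Rabs (t - T) < d). apply Rabs_lt_between. generalize (cond_pos d). lra.
      * exfalso. assert (T <= T - d).
        { apply Hlub. intros t Ht. apply Rnot_lt_le. intros Hlt. apply Hno.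
          exists t. split; assumption. }
        generalize (cond_pos d). lra.
Qed.

Lemma right_half_plane_connected rho : connected_set (right_half_plane rho).
Proof.
  intros A B HA HB Hcov [[x1 y1] [Hz1 HAz]] [[x2 y2] [Hz2 HBz]].
  unfold right_half_plane in *. simpl in Hz1, Hz2.
  set (gamma := fun t => (x1 + t * (x2 - x1), y1 + t * (y2 - y1)) : C).
  assert (Hin : forall t, 0 <= t <= 1 -> rho < Re (gamma t)).
  { intros t Ht. unfold gamma, Re. simpl.
    replace (x1 + t * (x2 - x1)) with ((1 - t) * x1 + t * x2) by ring.
    destruct (Req_dec t 0) as [-> | Hne]; [lra|].
    assert (0 < t) by lra. nra. }
  assert (Haff : forall p q t, continuous (fun u : R => p + u * q) t).
  { intros p q t. apply (ex_derive_continuous (K := R_AbsRing) (V := R_NormedModule)).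
    auto_derive. trivial. }
  destruct (segment_connected gamma A B) as (t & Ht & HAt & HBt); try assumption.
  - intros t. apply filterlim_locally. intros eps.
    assert (K1 := proj1 (filterlim_locally (U := R_UniformSpace) _ _) (Haff x1 (x2 - x1) t) eps).
    assert (K2 := proj1 (filterlim_locally (U := R_UniformSpace) _ _) (Haff y1 (y2 - y1) t) eps).
    exact (filter_and _ _ K1 K2).
  - intros t Ht. apply Hcov, Hin, Ht.
  - unfold gamma. rewrite !Rmult_0_l, !Rplus_0_r. exact HAz.
  - unfold gamma. replace (x1 + 1 * (x2 - x1)) with x2 by ring.
    replace (y1 + 1 * (y2 - y1)) with y2 by ring. exact HBz.
  - exists (gamma t). repeat split; auto.
Qed.

(** * Squares of the coefficients *)

(** The half-plane of absolute convergence itself is the open set on which the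
    continuation lives. *)
Lemma not_singular_of_absolute_convergence b rho k :
  converges_absolutely_beyond b rho -> rho < k -> ~ dirichlet_series_singular_at b k.
Proof.
  intros Hb Hk Hsing. apply Hsing.
  exists (right_half_plane rho), (dirichlet_sum b).
  split; [apply right_half_plane_open|].
  split; [apply right_half_plane_connected|].
  split; [exists rho; intros s Hs; exact Hs|].
  split; [intros t Ht; unfold right_half_plane; simpl; lra|].
  split; [apply dirichlet_sum_holomorphic; exact Hb|].
  exists rho. intros s Hs. unfold is_dirichlet_series.
  apply (is_series_ext (V := C_NormedModule) (dirichlet_term b s)).
  - intros n. symmetry. apply Cdiv_nat_Cpow.
  - apply (is_series_dirichlet_sum b rho s Hb Hs).
Qed.

Lemma squares_converge_absolutely a alpha r :
  is_O_power a alpha -> converges_absolutely_beyond a r ->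
  converges_absolutely_beyond (fun n => a n ^ 2) (alpha + r).
Proof.
  intros [K [N HK]] Ha sigma Hs.
  apply (ex_series_incr_n _ N).
  apply (ex_series_le (V := R_CompleteNormedModule) _
    (fun n => K * (Rabs (a (S (N + n))) * Rpower (INR (S (N + n))) (- (sigma - alpha))))).
  - intros n. specialize (HK (S (N + n)) ltac:(lia)).
    set (x := a (S (N + n))) in *. set (m := INR (S (N + n))) in *.
    apply Rle_trans with (1 := Req_le _ _ (Rabs_pos_eq _
      (Rmult_le_pos _ _ (Rabs_pos _) (Rlt_le _ _ (exp_pos _))))).
    rewrite <- RPow_abs. simpl. rewrite Rmult_1_r.
    replace (- (sigma - alpha)) with (alpha + - sigma) by ring.
    rewrite Rpower_plus.
    replace (K * (Rabs x * (Rpower m alpha * Rpower m (- sigma)))) with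
      (Rabs x * (K * Rpower m alpha) * Rpower m (- sigma)) by ring.
    apply Rmult_le_compat_r; [left; apply exp_pos|].
    apply Rmult_le_compat_l; [apply Rabs_pos | exact HK].
  - apply (ex_series_scal (V := R_NormedModule) K).
    apply (ex_series_incr_n (fun n => Rabs (a (S n)) * Rpower (INR (S n)) (- (sigma - alpha))) N).
    apply Ha. lra.
Qed.

Lemma extends_opp a M : extends_dirichlet_series a M ->
  extends_dirichlet_series (fun n => - a n) (fun s => - M s)%C.
Proof.
  intros [sigma0 H]. exists sigma0. intros s Hs.
  apply (is_series_ext (V := C_NormedModule)
    (fun n => opp (Cdiv (RtoC (a (S n))) (nat_Cpow (S n) s)))).
  - intros n. unfold Cdiv. rewrite RtoC_opp.
    change (- (a (S n) * / nat_Cpow (S n) s) = - a (S n) * / nat_Cpow (S n) s)%C. ring.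
  - apply (is_series_opp (V := C_NormedModule)). apply H. exact Hs.
Qed.

Theorem theorem4 (a : nat -> R) (alpha r k : R)
  (a_bound : is_O_power a alpha)
  (r_ge0 : 0 <= r)
  (a_continuation :
     exists M : C -> C,
       holomorphic_on (right_half_plane r) M /\
       extends_dirichlet_series a M /\
       polynomial_growth r M)
  (k_gt0 : 0 < k)
  (a2_singular : dirichlet_series_singular_at (fun n => (a n) ^ 2) k)
  (alpha_r_lt_k : alpha + r < k) :
  changes_signs_infinitely_often a.
Proof.
  destruct a_continuation as (M & Hhol & Hext & _).
  assert (Hnot : ~ converges_absolutely_beyond a r).
  { intros Ha.
    exact (not_singular_of_absolute_convergence _ _ k
      (squares_converge_absolutely a alpha r a_bound Ha) alpha_r_lt_k a2_singular). }
  split; intros N; apply NNPP; intros Hno; apply Hnot.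
  - intros sigma Hsigma.
    apply (ex_series_ext (fun n => Rabs (- a (S n)) * Rpower (INR (S n)) (- sigma))).
    { intros n. rewrite Rabs_Ropp. reflexivity. }
    apply (landau_absolute_convergence (fun n => - a n) (fun s => - M s)%C r).
    + intros z Hz. apply (ex_derive_opp (V := C_NormedModule)), Hhol, Hz.
    + apply extends_opp, Hext.
    + exists (S N). intros n Hn. apply Rnot_lt_le. intros Hlt. apply Hno. exists n.
      split; [exact Hn | lra].
    + exact Hsigma.
  - apply (landau_absolute_convergence a M r); try assumption.
    exists (S N). intros n Hn. apply Rnot_lt_le. intros Hlt. apply Hno. exists n.
    split; [exact Hn | lra].
Qed.
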